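(* Let $d,T\ge 1$, let $m$ be an even positive integer, let $n\ge 1$, and let $\tau\ge1$. Let $\sigma:\mathbb{R}\to\mathbb{R}$ be twice differentiable with $|\sigma(u)|\le\sigma_0$, $|\sigma'(u)|\le\sigma_1$, $|\sigma''(u)|\le\sigma_2$ for all $u$, where $\bar\sigma=(\sigma_0,\sigma_1,\sigma_2)\in(0,\infty)^3$. Let $\bar\nu=(\bar\nu_c,\bar\nu_u,\bar\nu_w)\in(0,\infty)^3$ and $\rho=(\rho_c,\rho_u,\rho_w)\in(0,\infty)^3$ with $\rho\ge\bar\nu$ componentwise. Let $f^\star=\tilde f(\cdot;v)\in\mathcal{F}_{\bar\nu}$ for some $v\in\mathcal{V}_{\bar\nu}$, let $X^{(1)},\dots,X^{(n)}\in\mathcal{X}$ and $y^{(j)}=f^\star(X^{(j)})$. Run projected gradient descent $\varphi^{(s+1)}=\Pi_{\Omega_\rho}\big(\varphi^{(s)}-\eta\nabla_\varphi\widehat{\mathcal L}_n(\varphi^{(s)})\big)$, $s=0,1,\dots$, from the symmetric initialization $\varphi^{(0)}$ with step size $\eta=1/\sqrt{\tau}$. Let $\delta,\delta'\in(0,1)$. Then there is a constant $C>0$ depending only on $\bar\sigma,\bar\nu,\rho$ such that on the event $\mathcal{E}_{U,m}(\delta')\cap\mathcal{E}_{\mathrm{app}}(\delta)$, \[ \min_{0\le s<\tau}\widehat{\mathcal L}_n(\varphi^{(s)})\le C\Big[\frac{L_{1,m}(\delta')^4}{\sqrt\tau}+L_{1,m}(\delta')\Big(B_{\mathrm{app},m}(\delta)+B_{\mathrm{lin},m}(\delta')+\frac{L_{1,m}(\delta')+L_{2,m}(\delta')}{\sqrt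 m}\Big)\Big], \] and the average iterate $\bar\varphi^{(\tau)}=\frac1\tau\sum_{s=0}^{\tau-1}\varphi^{(s)}$ satisfies \[ \widehat{\mathcal L}_n(\bar\varphi^{(\tau)})\le C\Big[\frac{L_{1,m}(\delta')^4}{\sqrt\tau}+L_{1,m}(\delta')\Big(B_{\mathrm{app},m}(\delta)+B_{\mathrm{lin},m}(\delta')+\frac{L_{1,m}(\delta')+L_{2,m}(\delta')}{\sqrt m}\Big)+B_{\mathrm{lin},m}(\delta')^2\Big]. \]
   Context: Data: $\mathcal{X}=\{X=(X_1,\dots,X_T)\in\mathbb{R}^{d\times T}:\max_t\|X_t\|_2\le1\}$; for each $X\in\mathcal X$ a fixed query $q_X\in\mathbb{R}^d$ with $\|q_X\|_2\le1$. Softmax $\sigma_s:\mathbb{R}^T\to\Delta_T$, $(\sigma_s(z))_t=e^{z_t}/\sum_s e^{z_s}$, with Jacobian $J_s(z)=\operatorname{diag}(\sigma_s(z))-\sigma_s(z)\sigma_s(z)^\top$. For $W\in\mathbb{R}^{d\times d}$: $a(X;W)=X\sigma_s(X^\top Wq_X)$ and $M(X;W)=XJ_s(X^\top Wq_X)X^\top$. For $\theta=(U,\operatorname{vec}(W))$, $U\in\mathbb{R}^d$: $h(X;\theta)=\sigma(U^\top a(X;W))$. Model: $f(X;\varphi)=m^{-1/2}\sum_{i=1}^m c_ih(X;\theta_i)$, $\varphi=(\varphi_1,\dots,\varphi_m)$, $\varphi_i=(c_i,U_i,\operatorname{vec}(W_i))\in\mathbb{R}\times\mathbb{R}^d\times\mathbb{R}^{d^2}$.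 Loss $\widehat{\mathcal L}_n(\varphi)=\frac1n\sum_{j=1}^n(f(X^{(j)};\varphi)-y^{(j)})^2$. Symmetric initialization $\varphi^{(0)}$: for $i\le m/2$, independently, $W_i^{(0)}$ has i.i.d. $\mathcal N(0,1)$ entries, $U_i^{(0)}\sim\mathcal N(0,I_d)$, $c_i^{(0)}$ uniform on $\{-1,1\}$; and $W_{i+m/2}^{(0)}=W_i^{(0)}$, $U_{i+m/2}^{(0)}=U_i^{(0)}$, $c_{i+m/2}^{(0)}=-c_i^{(0)}$. $\Omega_\rho=\{\varphi:|c_i-c_i^{(0)}|\le\rho_c/\sqrt m,\ \|U_i-U_i^{(0)}\|_2\le\rho_u/\sqrt m,\ \|W_i-W_i^{(0)}\|_F\le\rho_w/\sqrt m\ \forall i\in[m]\}$; $\Pi_{\Omega_\rho}$ is Euclidean projection. $B_{U,m}(\delta')=\sqrt d+\sqrt{2\log(m/(2\delta'))}+\rho_u/\sqrt m$; $L_{1,m}(\delta')=\sigma_1\sqrt{1+B_{U,m}(\delta')^2}$; $L_{2,m}(\delta')=\sigma_2(1+B_{U,m}(\delta')^2)+8\sigma_1\sqrt{1+B_{U,m}(\delta')^2}$; $B_{\mathrm{lin},m}(\delta')=\frac1{\sqrt m}\big(L_{1,m}(\delta')\rho_c\sqrt{\rho_w^2+\rho_u^2}+L_{2,m}(\delta')(\rho_w^2+\rho_u^2)\big)$; $B_{\mathrm{app},m}(\delta)=2(\sigma_0\bar\nu_c+\sigma_1\bar\nu_u+\sigma_1\bar\nu_w)\sqrt{2\log(2n/\delta)/m}$.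 Event $\mathcal E_{U,m}(\delta')=\{\max_{i\in[m]}\|U_i^{(0)}\|_2\le\sqrt d+\sqrt{2\log(m/(2\delta'))}\}$. Function class: let $\varphi_0=(c,U,\operatorname{vec}(W))$ have the law of $\varphi_1^{(0)}$; set $\phi_c(X)=\sigma(U^\top a(X;W))$, $\phi_u(X)=\sigma'(U^\top a(X;W))a(X;W)$, $\phi_w(X)=\sigma'(U^\top a(X;W))(M(X;W)U)q_X^\top$. For measurable $v=(v_c,v_u,v_w):\mathbb{R}^{d^2+d+1}\to\mathbb{R}\times\mathbb{R}^d\times\mathbb{R}^{d\times d}$, $\tilde f(X;v)=\mathbb E[\phi_c(X)v_c(\varphi_0)]+\mathbb E[\langle\phi_u(X),v_u(\varphi_0)\rangle]+\mathbb E[\langle\phi_w(X),v_w(\varphi_0)\rangle_F]$. $\mathcal V_{\bar\nu}$ is the set of such $v$ with $\sup|v_c|\le\bar\nu_c$, $\sup\|v_u\|_2\le\bar\nu_u$, $\sup\|v_w\|_F\le\bar\nu_w$, and $\mathcal F_{\bar\nu}=\{\tilde f(\cdot;v):v\in\mathcal V_{\bar\nu}\}$. Linear model: $f_{\mathrm{lin}}(X;\varphi)=f(X;\varphi^{(0)})+\langle\nabla_\varphi f(X;\varphi^{(0)}),\varphi-\varphi^{(0)}\rangle$. Transported parameters $\tilde\varphi$: $\tilde c_i=c_i^{(0)}+m^{-1/2}v_c(\varphi_i^{(0)})$, $\tilde U_i=U_i^{(0)}+c_i^{(0)}m^{-1/2}v_u(\varphi_i^{(0)})$, $\tilde W_i=W_i^{(0)}+c_i^{(0)}m^{-1/2}v_w(\varphi_i^{(0)})$.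 Event $\mathcal E_{\mathrm{app}}(\delta)=\{\sup_{j\in[n]}|f_{\mathrm{lin}}(X^{(j)};\tilde\varphi)-\tilde f(X^{(j)};v)|\le B_{\mathrm{app},m}(\delta)\}$ (for the $v$ representing $f^\star$). *)

(* Defs.v *)
From HB Require Import structures.
From mathcomp Require Import all_boot all_order all_algebra.
From mathcomp Require Import all_classical all_reals all_analysis.
Set Implicit Arguments.
Unset Strict Implicit.
Unset Printing Implicit Defensive.
Import Order.TTheory GRing.Theory Num.Def Num.Theory.
Local Open Scope ring_scope.

Section Defs.
Variable R : realType.

Definition vec (d : nat) := 'I_d -> R.
Definition mat (d : nat) := 'I_d -> 'I_d -> R.
Definition dat (d T : nat) := 'I_d -> 'I_T -> R.

Definition norm2 d (u : vec d) : R := Num.sqrt (\sum_k u k ^+ 2).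
Definition frob d (w : mat d) : R := Num.sqrt (\sum_k \sum_l w k l ^+ 2).

Definition in_Xset d T (X : dat d T) : Prop :=
  forall t : 'I_T, Num.sqrt (\sum_k X k t ^+ 2) <= 1.

Definition softmax T (z : 'I_T -> R) (t : 'I_T) : R :=
  expR (z t) / \sum_s expR (z s).
Definition softmax_jac T (z : 'I_T -> R) (t s : 'I_T) : R :=
  (t == s)%:R * softmax z t - softmax z t * softmax z s.

Section Model.
Variables (d T : nat) (q : dat d T -> vec d) (sig : R -> R).

Definition scores (X : dat d T) (W : mat d) : 'I_T -> R :=
  fun t => \sum_k X k t * \sum_l W k l * q X l.
Definition attn (X : dat d T) (W : mat d) : vec d :=
  fun k => \sum_t X k t * softmax (scores X W) t.
Definition Mmat (X : dat d T) (W : mat d) : mat d :=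
  fun k l => \sum_t \sum_s X k t * softmax_jac (scores X W) t s * X l s.
Definition hneuron (X : dat d T) (U : vec d) (W : mat d) : R :=
  sig (\sum_k U k * attn X W k).

Record param (m : nat) := Param {
  pc : 'I_m -> R ; pU : 'I_m -> vec d ; pW : 'I_m -> mat d }.

Definition model m (phi : param m) (X : dat d T) : R :=
  (Num.sqrt (m%:R))^-1 * \sum_i pc phi i * hneuron X (pU phi i) (pW phi i).

Definition loss m n (Xs : 'I_n -> dat d T) (ys : 'I_n -> R) (phi : param m) : R :=
  (n%:R)^-1 * \sum_j (model phi (Xs j) - ys j) ^+ 2.

Definition padd m (x y : param m) : param m :=
  Param (fun i => pc x i + pc y i) (fun i k => pU x i k + pU y i k)
        (fun i k l => pW x i k l + pW y i k l).
Definition pscale m (a : R) (x : param m) : param m :=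
  Param (fun i => a * pc x i) (fun i k => a * pU x i k) (fun i k l => a * pW x i k l).
Definition psub m (x y : param m) : param m := padd x (pscale (-1) y).
Definition pdot m (x y : param m) : R :=
  \sum_i (pc x i * pc y i + \sum_k pU x i k * pU y i k
          + \sum_k \sum_l pW x i k l * pW y i k l).
Definition pdist2 m (x y : param m) : R := pdot (psub x y) (psub x y).

Definition pgrad m (F : param m -> R) (phi : param m) : param m :=
  Param
    (fun i => derive1 (fun t => F (Param (fun i' => pc phi i' + (i' == i)%:R * t)
                                          (pU phi) (pW phi))) 0)
    (fun i k => derive1 (fun t => F (Param (pc phi)
          (fun i' k' => pU phi i' k' + ((i' == i) && (k' == k))%:R * t) (pW phi))) 0)
    (fun i k l => derive1 (fun t => F (Param (pc phi) (pU phi)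
          (fun i' k' l' => pW phi i' k' l'
                 + [&& i' == i, k' == k & l' == l]%:R * t))) 0).

Definition in_Omega m (rc ru rw : R) (phi0 phi : param m) : Prop :=
  forall i, `|pc phi i - pc phi0 i| <= rc / Num.sqrt (m%:R)
         /\ norm2 (fun k => pU phi i k - pU phi0 i k) <= ru / Num.sqrt (m%:R)
         /\ frob (fun k l => pW phi i k l - pW phi0 i k l) <= rw / Num.sqrt (m%:R).

(* symmetric initialization (support of the random initialization) *)
Definition sym_init m (phi0 : param m) : Prop :=
  (forall i, pc phi0 i = 1 \/ pc phi0 i = -1) /\
  (forall i j : 'I_m, (j : nat) = (i + m./2)%N ->
     pW phi0 j = pW phi0 i /\ pU phi0 j = pU phi0 i /\ pc phi0 j = - pc phi0 i).

Definition f_lin m (phi0 phi : param m) (X : dat d T) : R :=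
  model phi0 X + pdot (pgrad (fun p => model p X) phi0) (psub phi phi0).

End Model.

(* Expectation w.r.t. k i.i.d. N(0,1) coordinates z_0,...,z_{k-1}
   (iterated Lebesgue integrals against the standard normal law) *)
Fixpoint gaussE (k : nat) (g : (nat -> R) -> R) : R :=
  match k with
  | 0 => g (fun _ => 0)
  | k'.+1 => Rintegral (normal_prob (0 : R) 1) setT
      (fun x : R => gaussE k' (fun z => g (fun j => if j == k' then x else z j)))
  end.

(* E[F(c,U,W)] for (c,U,W) ~ law of phi_1^(0):
   c uniform on {-1,1}, U ~ N(0,I_d), W with i.i.d. N(0,1) entries, independent *)
Definition initE d (F : R -> vec d -> mat d -> R) : R :=
  2^-1 * \sum_(c <- [:: 1; -1])
     gaussE (d + d * d) (fun z => F c (fun k => z (k : nat))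
                                      (fun k l => z (d + k * d + l)%N)).

Section FunctionClass.
Variables (d T : nat) (q : dat d T -> vec d) (sig : R -> R).

Definition phi_c (X : dat d T) (U : vec d) (W : mat d) : R :=
  sig (\sum_k U k * attn q X W k).
Definition phi_u (X : dat d T) (U : vec d) (W : mat d) : vec d :=
  fun k => derive1 sig (\sum_k U k * attn q X W k) * attn q X W k.
Definition phi_w (X : dat d T) (U : vec d) (W : mat d) : mat d :=
  fun k l => derive1 sig (\sum_k U k * attn q X W k)
             * (\sum_j Mmat q X W k j * U j) * q X l.

Variables (vc : R -> vec d -> mat d -> R) (vu : R -> vec d -> mat d -> vec d)
          (vw : R -> vec d -> mat d -> mat d).

Definition ftilde (X : dat d T) : R :=
  initE (fun c U W => phi_c X U W * vc c U W)
  + initE (fun c U W => \sum_k phi_u X U W k * vu c U W k)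
  + initE (fun c U W => \sum_k \sum_l phi_w X U W k l * vw c U W k l).

Definition transport m (phi0 : param d m) : param d m :=
  Param (fun i => pc phi0 i + (Num.sqrt (m%:R))^-1 * vc (pc phi0 i) (pU phi0 i) (pW phi0 i))
        (fun i k => pU phi0 i k + pc phi0 i * (Num.sqrt (m%:R))^-1
                       * vu (pc phi0 i) (pU phi0 i) (pW phi0 i) k)
        (fun i k l => pW phi0 i k l + pc phi0 i * (Num.sqrt (m%:R))^-1
                       * vw (pc phi0 i) (pU phi0 i) (pW phi0 i) k l).
End FunctionClass.

Definition decode d (t : (1 + d + d * d).-tuple R) :
  R * vec d * mat d :=
  (nth 0 t 0, (fun k : 'I_d => nth 0 t (1 + k)%N), (fun k l : 'I_d => nth 0 t (1 + d + k * d + l)%N)).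

(* v = (v_c, v_u, v_w) \in \mathcal V_{\bar\nu}: measurable (w.r.t. the Borel
   sigma-algebra of R^{d^2+d+1}, i.e. each output coordinate is measurable)
   and uniformly bounded *)
Definition in_V d (nc nu nw : R) (vc : R -> vec d -> mat d -> R)
    (vu : R -> vec d -> mat d -> vec d) (vw : R -> vec d -> mat d -> mat d) : Prop :=
  measurable_fun setT (fun t => let: (c, U, W) := decode t in vc c U W) /\
  (forall k, measurable_fun setT (fun t => let: (c, U, W) := decode t in vu c U W k)) /\
  (forall k l, measurable_fun setT (fun t => let: (c, U, W) := decode t in vw c U W k l)) /\
  (forall c U W, `|vc c U W| <= nc) /\
  (forall c U W, norm2 (vu c U W) <= nu) /\
  (forall c U W, frob (vw c U W) <= nw).

Definition B_U (d m : nat) (ru dl' : R) : R :=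
  Num.sqrt (d%:R) + Num.sqrt (2 * ln (m%:R / (2 * dl'))) + ru / Num.sqrt (m%:R).
Definition L1 (s1 : R) d m ru dl' : R := s1 * Num.sqrt (1 + B_U d m ru dl' ^+ 2).
Definition L2 (s1 s2 : R) d m ru dl' : R :=
  s2 * (1 + B_U d m ru dl' ^+ 2) + 8 * s1 * Num.sqrt (1 + B_U d m ru dl' ^+ 2).
Definition B_lin (s1 s2 rc ru rw : R) d m dl' : R :=
  (Num.sqrt (m%:R))^-1 * (L1 s1 d m ru dl' * rc * Num.sqrt (rw ^+ 2 + ru ^+ 2)
                          + L2 s1 s2 d m ru dl' * (rw ^+ 2 + ru ^+ 2)).
Definition B_app (s0 s1 nc nu nw : R) (n m : nat) (dl : R) : R :=
  2 * (s0 * nc + s1 * nu + s1 * nw) * Num.sqrt (2 * ln (2 * n%:R / dl) / m%:R).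

Definition event_U d m (phi0 : param d m) (dl' : R) : Prop :=
  forall i, norm2 (pU phi0 i) <= Num.sqrt (d%:R) + Num.sqrt (2 * ln (m%:R / (2 * dl'))).

End Defs.

(* Main.v *)
(* Along a segment of attention parameters the softmax logits move affinely, so
   the attention output is a Gibbs average and its derivatives are covariances;
   hence each neuron is Lipschitz and has a second-order remainder controlled by
   L1 and L2, and the model differs from its linearization, at any point of the
   projection set, by O((L1 + L2) / sqrt m).  Expanding the squared distance of
   the iterates to the transported parameters z (a convex projection cannot
   increase it) bounds the averaged inner products <grad L(phi_s), phi_s - z>.
   Each of them is 2 L(phi_s) up to the error with which the linearization at
   phi_s fits the targets at z, and that error is B_app plus two linearization
   errors.  Passing to the averaged iterate costs two more linearization errors,
   because the model linearized at initialization is affine.  The residuals are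
   O(L1) because the targets are: this uses E |U| <= C sqrt d. *)

Require Import Defs.
From HB Require Import structures.
From mathcomp Require Import all_boot all_order all_algebra.
From mathcomp Require Import all_classical all_reals all_analysis.
From mathcomp Require Import measurable_realfun ring lra.
Import Order.TTheory GRing.Theory Num.Def Num.Theory.
Local Open Scope ring_scope.

Set Implicit Arguments.
Unset Strict Implicit.
Unset Printing Implicit Defensive.

(** The constant may depend on none of [d], [T], [m], [n], [tau], so the estimates are measured in
    one scale, [S = sqrt (1 + B_U^2)], for which [L1 = s1 * S]. This [S] dominates 1, [sqrt d], and
    on the event also [norm2 (pU x i)] for every [x] in the projection set; terms lacking a factor
    [S] are absorbed through [1 <= S]. The powers follow: residuals and the gradient of the model
    are both O(L1), so the squared gradient of the loss is O(L1^4), while the squared distance to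
    the comparator is O(1), since each of the [m] neurons moves by O(1 / sqrt m). The fit error
    enters multiplied by a residual, not squared, whence the factor [L1] in front of [B_app]. Two
    definitions shape the rest. [pgrad] consists of partial derivatives only, so its pairing with a
    direction is obtained from directional derivatives shown to be linear. [gaussE] is an iterated
    integral, and its inner integrals are not known to be measurable in the remaining variables; the
    target bound therefore rests on pointwise quadratic domination alone, without Fubini. *)

(* The imported instances would change how [derivable sig u 1] elaborates in the
   theorem; leaving the section drops them. *)
Section Development.
Import numFieldNormedType.Exports.

(** * Gaussian second moments *)

Import HBNNSimple.

(** The fibers of [h] partition the space, so the fiberwise inequalities add up to [a] times the
    mass of [P] plus [b] times the mass of [Q], and both masses are 1. *)
Lemma sintegral_le_fibers (R : realType) disp (T : measurableType disp)
    (P Q : probability T R) (h : {nnsfun T >-> R}) (a b : R) :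
  (forall x, measurable (h @^-1` [set h x])%classic ->
    ((h x)%:E * P (h @^-1` [set h x])%classic
     <= a%:E * P (h @^-1` [set h x])%classic
        + b%:E * Q (h @^-1` [set h x])%classic)%E) ->
  (sintegral P h <= (a + b)%:E)%E.
Proof.
move=> hle.
have sumZ (k : R) (Q' : probability T R) :
    (\sum_(y \in range h) k%:E * Q' (h @^-1` [set y])%classic = k%:E)%E.
  rewrite -ge0_mule_fsumr; last by move=> y; exact: measure_ge0.
  rewrite -measure_fin_bigcup//.
  - have -> : (\bigcup_(y in range h) h @^-1` [set y] = setT)%classic.
      by apply/seteqP; split => // x _; exists (h x) => //; exists x.
    by have /= -> := probability_setT Q'; rewrite mule1.
  - apply/trivIsetP => i j _ _ ij; apply/seteqP; split => // x [/= ->].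
    by move/eqP; rewrite (negPf ij).
rewrite sintegralE EFinD -(sumZ a P) -(sumZ b Q) -fsbig_split; last exact: (@fimfunP _ _ h).
apply: lee_fsum; first exact: (@fimfunP _ _ h).
by move=> y [x _ <-]; apply: hle.
Qed.

Section GaussianMoment.
Variable R : realType.

Let P : probability (measurableTypeR R) R := normal_prob (0 : R) 1.
Let P2 : probability (measurableTypeR R) R := normal_prob (0 : R) 2.
Definition m2bound : R := 3 * normal_peak 1 / normal_peak 2.

(** [m2bound] plays the part of the second moment of N(0,1): any absolute constant serves, and this
    one comes from the comparison with the density of standard deviation 2. *)
Lemma m2bound_ge0 : 0 <= m2bound.
Proof. by rewrite /m2bound !mulr_ge0 ?invr_ge0 ?normal_peak_ge0. Qed.

(** Up to the peaks the claim is [x^2 <= 3 exp (3 x^2 / 8)], where 3/8 = 1/2 - 1/8 is the gap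
    between the two exponents; it follows from [1 + u <= exp u]. *)
Lemma sqr_normal_pdf_le (x : R) :
  x ^+ 2 * normal_pdf 0 1 x <= m2bound * normal_pdf 0 2 x.
Proof.
rewrite !normal_pdfE ?oner_neq0 ?pnatr_eq0// /normal_fun subr0 expr1n.
have p1 : 0 < normal_peak (1 : R) by rewrite normal_peak_gt0 ?oner_neq0.
have p2 : 0 < normal_peak (2 : R) by rewrite normal_peak_gt0 ?pnatr_eq0.
have -> : m2bound * (normal_peak 2 * expR (- x ^+ 2 / (2 ^+ 2 *+ 2)))
    = normal_peak 1 * (3 * expR (- x ^+ 2 / (2 ^+ 2 *+ 2))).
  by rewrite /m2bound; field; rewrite gt_eqF.
rewrite mulrCA ler_pM2l//.
have -> : - x ^+ 2 / (2 ^+ 2 *+ 2) = 3 / 8 * x ^+ 2 + - x ^+ 2 / (1 *+ 2).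
  by field.
rewrite expRD mulrA ler_wpM2r ?expR_ge0//.
have := expR_ge1Dx (3 / 8 * x ^+ 2); have := sqr_ge0 x; lra.
Qed.

(* [y] is meant to be a value of a simple function below [a + b x^2] and [A] the
   corresponding fiber: the density of N(0,1) times [x^2] is dominated by a
   multiple of the density of N(0,4), so no change of variables is needed. *)
Lemma normal_prob_weight_le (a b y : R) (A : set (measurableTypeR R)) : 0 <= a -> 0 <= b -> 0 <= y ->
  measurable A -> (forall x, A x -> y <= a + b * x ^+ 2) ->
  (y%:E * P A <= a%:E * P A + (m2bound * b)%:E * P2 A)%E.
Proof.
move=> a0 b0 y0 mA yA.
have M0 := m2bound_ge0.
have mpdf s : measurable_fun (T := measurableTypeR R) A (fun x : R => (normal_pdf 0 s x)%:E).
  by apply/measurable_funTS/measurable_EFinP; exact: measurable_normal_pdf.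
have pdf0 s (x : R) : A x -> (0 <= (normal_pdf 0 s x)%:E)%E.
  by rewrite lee_fin normal_pdf_ge0.
have Zl k s : 0 <= k -> (k%:E * \int[lebesgue_measure]_(x in A) (normal_pdf 0 s x)%:E
    = \int[lebesgue_measure]_(x in A) (k%:E * (normal_pdf 0 s x)%:E))%E.
  move=> k0; by rewrite ge0_integralZl ?lee_fin// => x; exact: pdf0.
have Mb0 : 0 <= m2bound * b by rewrite mulr_ge0.
rewrite /P /P2 /= /normal_prob !Zl// -ge0_integralD//.
- apply: ge0_le_integral => //.
  + by move=> x Ax; apply: mule_ge0; [rewrite lee_fin|exact: pdf0].
  + exact: measurable_funeM.
  + by apply: emeasurable_funD; exact: measurable_funeM.
  + move=> x Ax; rewrite -!EFinM -EFinD lee_fin.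
    apply: (le_trans (ler_wpM2r (normal_pdf_ge0 0 1 x) (yA x Ax))).
    rewrite mulrDl lerD2l -mulrA [m2bound * b]mulrC -[leRHS]mulrA.
    by rewrite ler_wpM2l// sqr_normal_pdf_le.
- by move=> x Ax; apply: mule_ge0; [rewrite lee_fin|exact: pdf0].
- exact: measurable_funeM.
- by move=> x Ax; apply: mule_ge0; [rewrite lee_fin|exact: pdf0].
- exact: measurable_funeM.
Qed.

Lemma normal_sintegral_le (a b : R) (h : {nnsfun (measurableTypeR R) >-> R}) : 0 <= a -> 0 <= b ->
  (forall x, h x <= a + b * x ^+ 2) ->
  (sintegral P h <= (a + m2bound * b)%:E)%E.
Proof.
move=> a0 b0 hle; apply: (@sintegral_le_fibers _ _ _ P P2) => x mhx.
by apply: normal_prob_weight_le => // z /= <-; exact: hle.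
Qed.

(* [F] need not be measurable: the integral of a nonnegative function is a
   supremum over the simple functions below it. *)
Lemma normal_Rintegral_le (a b : R) (F : R -> R) : 0 <= a -> 0 <= b ->
  (forall x, `|F x| <= a + b * x ^+ 2) ->
  `| Rintegral P setT F | <= a + m2bound * b.
Proof.
move=> a0 b0 Fle.
have key (G : R -> \bar R) : (forall x, (0 <= G x <= (a + b * x ^+ 2)%:E)%E) ->
    (0 <= \int[P]_x G x <= (a + m2bound * b)%:E)%E.
  move=> G0; apply/andP; split; first by apply: integral_ge0 => x _; case/andP: (G0 x).
  rewrite ge0_integralTE; last by move=> x; case/andP: (G0 x).
  apply: ge_ereal_sup => _ [h /= hG <-]; apply: normal_sintegral_le => // x.
  by rewrite -lee_fin (le_trans (hG x))//; case/andP: (G0 x).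
rewrite /Rintegral integralE.
have /key/andP[p0 p1] : (forall x, (0 <= (fun x => (F x)%:E)^\+ x <= (a + b * x ^+ 2)%:E)%E).
  move=> x; rewrite funepos_ge0 funeposE -EFin_max lee_fin ge_max.
  by rewrite (le_trans (ler_norm _) (Fle x)) (le_trans (normr_ge0 _) (Fle x)).
have /key/andP[n0 n1] : (forall x, (0 <= (fun x => (F x)%:E)^\- x <= (a + b * x ^+ 2)%:E)%E).
  move=> x; rewrite funeneg_ge0 funenegE -EFinN -EFin_max lee_fin ge_max.
  by rewrite (le_trans (normr_ge0 _) (Fle x)) andbT (le_trans _ (Fle x))// -normrN ler_norm.
(* Both parts lie between 0 and the same finite bound. This excludes infinite integrals and bounds
   the difference without a factor 2. *)
move: p0 p1 n0 n1.
case: (integral _ _ _) => [p| |]//=; case: (integral _ _ _) => [r| |]//=.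
rewrite !lee_fin => ? ? ? ?; rewrite ler_norml; lra.
Qed.

End GaussianMoment.

(** * Finite sums and derivatives *)

Section FiniteSums.
Variable R : realType.

(** Lagrange's identity: the double sum of the squares [(a i * b j - a j * b i) ^+ 2] is twice the
    defect of the inequality. *)
Lemma cauchy_schwarz_sum (I : finType) (a b : I -> R) :
  (\sum_i a i * b i) ^+ 2 <= (\sum_i a i ^+ 2) * (\sum_i b i ^+ 2).
Proof.
have : 0 <= \sum_i \sum_j (a i * b j - a j * b i) ^+ 2.
  by apply: sumr_ge0 => i _; apply: sumr_ge0 => j _; exact: sqr_ge0.
have -> : \sum_i \sum_j (a i * b j - a j * b i) ^+ 2 =
    2 * ((\sum_i a i ^+ 2) * (\sum_i b i ^+ 2) - (\sum_i a i * b i) ^+ 2).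
  transitivity (\sum_i \sum_j (a i ^+ 2 * b j ^+ 2 + b i ^+ 2 * a j ^+ 2
      - 2 * ((a i * b i) * (a j * b j)))).
    by apply: eq_bigr => i _; apply: eq_bigr => j _; ring.
  under eq_bigr do rewrite sumrB big_split/= -!mulr_sumr.
  by rewrite sumrB big_split/= -mulr_sumr -!mulr_suml; ring.
lra.
Qed.

Lemma ler_sqrt_sqr (x y : R) : x ^+ 2 <= y -> `|x| <= Num.sqrt y.
Proof. by move=> xy; rewrite -sqrtr_sqr ler_wsqrtr. Qed.

Lemma norm2_ge0 d (u : vec R d) : 0 <= norm2 u. Proof. exact: sqrtr_ge0. Qed.
Lemma frob_ge0 d (w : mat R d) : 0 <= frob w. Proof. exact: sqrtr_ge0. Qed.

Lemma sqr_norm2 d (u : vec R d) : norm2 u ^+ 2 = \sum_k u k ^+ 2.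
Proof. by rewrite sqr_sqrtr// sumr_ge0// => k _; exact: sqr_ge0. Qed.

Lemma sqr_frob d (w : mat R d) : frob w ^+ 2 = \sum_k \sum_l w k l ^+ 2.
Proof.
rewrite sqr_sqrtr// sumr_ge0// => k _.
by rewrite sumr_ge0// => l _; exact: sqr_ge0.
Qed.

Lemma norm_dot_le d (u v : vec R d) : `|\sum_k u k * v k| <= norm2 u * norm2 v.
Proof.
rewrite -sqrtrM ?ler_sqrt_sqr ?cauchy_schwarz_sum//.
by rewrite sumr_ge0// => k _; exact: sqr_ge0.
Qed.

Lemma norm_bilin_le d (u v : vec R d) (w : mat R d) :
  `|\sum_k u k * \sum_l w k l * v l| <= norm2 u * (frob w * norm2 v).
Proof.
apply: (le_trans (norm_dot_le u (fun k => \sum_l w k l * v l))).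
rewrite ler_wpM2l ?norm2_ge0// /norm2 /frob -sqrtrM; last first.
  by rewrite sumr_ge0// => k _; rewrite sumr_ge0// => l _; exact: sqr_ge0.
rewrite ler_wsqrtr// mulr_suml ler_sum// => k _; exact: cauchy_schwarz_sum.
Qed.

End FiniteSums.

Section Derivatives.
Variable R : realType.
Implicit Types f g : R -> R.

(** This rule and the next ones are restated for functions written as abstractions, with products of
    reals, the shape in which the curves below present themselves. *)
Lemma is_deriveD_fun f g (x a b : R) : is_derive x 1 f a -> is_derive x 1 g b ->
  is_derive x 1 (fun t => f t + g t) (a + b).
Proof. exact: is_deriveD. Qed.

Lemma is_deriveM_fun f g (x a b : R) : is_derive x 1 f a -> is_derive x 1 g b ->
  is_derive x 1 (fun t => f t * g t) (a * g x + f x * b).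
Proof.
move=> fa gb; apply: is_derive_eq (is_deriveM fa gb) _.
by rewrite addrC; congr (_ + _); exact: mulrC.
Qed.

Lemma is_deriveZ_fun f (k x a : R) : is_derive x 1 f a ->
  is_derive x 1 (fun t => k * f t) (k * a).
Proof.
move=> fa; apply: is_derive_eq (is_deriveM_fun (is_derive_cst k x 1) fa) _.
by rewrite mul0r add0r.
Qed.

Lemma is_derive_sum_fun n (f : 'I_n -> R -> R) (df : 'I_n -> R) (x : R) :
  (forall i, is_derive x 1 (f i) (df i)) ->
  is_derive x 1 (fun t => \sum_i f i t) (\sum_i df i).
Proof.
move=> fd; rewrite [X in is_derive _ _ X _](_ : _ = \sum_i f i).
  exact: is_derive_sum.
by apply/funext => t; rewrite fct_sumE.
Qed.

Lemma is_derive_affine (a b x : R) : is_derive x 1 (fun t => a + t * b) b.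
Proof.
have bd := is_deriveM_fun (is_derive_id x 1) (is_derive_cst b x 1).
apply: is_derive_eq (is_deriveD_fun (is_derive_cst a x 1) bd) _.
by rewrite mul1r mulr0 addr0 add0r.
Qed.

Lemma is_derive1E f (x a : R) : is_derive x 1 f a -> derive1 f x = a.
Proof. by move=> fa; rewrite derive1E derive_val. Qed.

Lemma is_derive_continuous f (df : R -> R) (x : R) :
  (forall t : R, is_derive t 1 f (df t)) -> {for x, continuous f}.
Proof.
move=> fd; apply: differentiable_continuous; apply/derivable1_diffP.
by have := fd x; case.
Qed.

(** The case [x = 0] is allowed on purpose: the second application in [second_order_remainder] is on
    [[0, c]], where [c] may vanish. *)
Lemma mean_value01 f (df : R -> R) (x : R) : 0 <= x ->
  (forall t : R, is_derive t 1 f (df t)) ->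
  exists2 c, 0 <= c <= x & f x - f 0 = df c * x.
Proof.
move=> x0 fd.
have fc : {within `[0, x], continuous f}%classic.
  by apply: continuous_subspaceT => t; exact: is_derive_continuous fd.
have [c cx ->] := @MVT_segment R f df 0 x x0 (fun t _ => fd t) fc.
by exists c; rewrite ?subr0//; rewrite in_itv in cx.
Qed.

(** The mean value theorem is applied to [f] and then to [df]; compared with Taylor's formula this
    only loses the factor 1/2. *)
Lemma second_order_remainder f (df ddf : R -> R) (K : R) :
  (forall t : R, is_derive t 1 f (df t)) -> (forall t : R, is_derive t 1 df (ddf t)) ->
  (forall t, 0 <= t <= 1 -> `|ddf t| <= K) ->
  `|f 1 - f 0 - df 0| <= K.
Proof.
move=> fd dfd ddK.
have [c /andP[c0 c1] ->] := @mean_value01 f df 1 ler01 fd.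
have [e /andP[e0 ec] eE] := @mean_value01 df ddf c c0 dfd.
rewrite mulr1 eE normrM (ger0_norm c0).
have eK : `|ddf e| <= K by apply: ddK; rewrite e0 (le_trans ec c1).
by apply: (le_trans _ eK); rewrite ler_piMr.
Qed.

End Derivatives.

(** * Softmax averages *)

Section SoftmaxAverage.
Variables (R : realType) (T : nat).
Hypothesis T_gt0 : (0 < T)%N.
Implicit Types (z g h al be : 'I_T -> R).

Definition savg z g : R := \sum_t g t * softmax z t.

Lemma sum_expR_gt0 z : 0 < \sum_s expR (z s).
Proof.
case: T T_gt0 z => // n _ z; rewrite big_ord_recl ltr_pwDl ?expR_gt0//.
by apply: sumr_ge0 => i _; exact: expR_ge0.
Qed.

Lemma norm_savg_le z g (G : R) : (forall t, `|g t| <= G) -> `|savg z g| <= G.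
Proof.
move=> gG.
have s1 : \sum_t softmax z t = 1.
  by rewrite -mulr_suml divff// gt_eqF// sum_expR_gt0.
rewrite -[G]mulr1 -s1 mulr_sumr; apply: (le_trans (ler_norm_sum _ _ _)).
apply: ler_sum => t _; have p0 : 0 <= softmax z t.
  by rewrite divr_ge0 ?expR_ge0// ltW// sum_expR_gt0.
by rewrite normrM (ger0_norm p0) ler_wpM2r.
Qed.

Definition scov z g h : R := savg z (fun t => g t * h t) - savg z g * savg z h.

Lemma norm_scov_le z g h (G H : R) : 0 <= G -> 0 <= H ->
  (forall t, `|g t| <= G) -> (forall t, `|h t| <= H) -> `|scov z g h| <= 2 * (G * H).
Proof.
move=> G0 H0 gG hH; rewrite mulr_natl mulr2n.
apply: (le_trans (ler_normB _ _)); apply: lerD.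
  by apply: norm_savg_le => t; rewrite normrM ler_pM.
by rewrite normrM ler_pM ?norm_savg_le.
Qed.

Lemma savgE z g : savg z g = (\sum_t g t * expR (z t)) / \sum_s expR (z s).
Proof. by rewrite mulr_suml; apply: eq_bigr => t _; rewrite mulrA. Qed.

Lemma is_derive_savg al be g (x : R) :
  is_derive x 1 (fun t => savg (fun s => al s + t * be s) g)
    (scov (fun s => al s + x * be s) g be).
Proof.
(* Unnormalized Gibbs sums: differentiating [N h] along the affine logits just multiplies the weight
   [h] by [be], so the quotient rule for [N g / N 1] produces the covariance. *)
pose N h t := \sum_s h s * expR (al s + t * be s).
have dN h : is_derive x 1 (N h) (N (fun s => h s * be s) x).
  rewrite /N; apply: is_derive_sum_fun => s.
  have de := is_derive1_comp (is_derive_expR _) (is_derive_affine (al s) (be s) x).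
  by apply: is_derive_eq (is_deriveZ_fun (h s) de) _; ring.
have NE h t : savg (fun s => al s + t * be s) h = N h t / N (fun=> 1) t.
  by rewrite savgE /N; congr (_ / _); apply: eq_bigr => s _; rewrite mul1r.
have N0 : N (fun=> 1) x != 0.
  rewrite /N; under eq_bigr do rewrite mul1r.
  by rewrite gt_eqF// sum_expR_gt0.
rewrite [X in is_derive _ _ X _](_ : _ = fun t => N g t * (N (fun=> 1) t)^-1); last first.
  by apply/funext => t; exact: NE.
apply: is_derive_eq (is_deriveM_fun (dN g) (is_deriveV N0 (dN (fun=> 1)))) _.
rewrite /scov !NE.
have -> : N (fun s => 1 * be s) x = N be x.
  by apply: eq_bigr => s _; rewrite mul1r.
by rewrite /GRing.scale/=; field.
Qed.

(** The value is the third joint cumulant of [g], [be], [be] under the Gibbs weights. *)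
Lemma is_derive_scov al be g (x : R) :
  is_derive x 1 (fun t => scov (fun s => al s + t * be s) g be)
    (scov (fun s => al s + x * be s) (fun s => g s * be s) be
     - (scov (fun s => al s + x * be s) g be * savg (fun s => al s + x * be s) be
        + savg (fun s => al s + x * be s) g * scov (fun s => al s + x * be s) be be)).
Proof.
have dM := is_deriveM_fun (is_derive_savg al be g x) (is_derive_savg al be be x).
exact: is_deriveB (is_derive_savg al be (fun s => g s * be s) x) dM.
Qed.

End SoftmaxAverage.

(** * A neuron along a segment *)

Section Curve.
Variables (R : realType) (T : nat).
Hypothesis T_gt0 : (0 < T)%N.
Variables al be ga ka : 'I_T -> R.

Let zt (t : R) : 'I_T -> R := fun s => al s + t * be s.

(** In the application [al] and [be] are the logits of [W] and of its increment, [ga] and [ka] the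
    products of the tokens with [U] and with its increment. The increment of [U] enters linearly,
    hence the explicit factor [t]. *)
Definition preact t := savg (zt t) ga + t * savg (zt t) ka.
Definition dpreact t :=
  scov (zt t) ga be + (savg (zt t) ka + t * scov (zt t) ka be).
Let dscov t g := scov (zt t) (fun s => g s * be s) be
  - (scov (zt t) g be * savg (zt t) be + savg (zt t) g * scov (zt t) be be).
Definition ddpreact t :=
  dscov t ga + (scov (zt t) ka be + (scov (zt t) ka be + t * dscov t ka)).

Lemma is_derive_preact (t : R) : is_derive t 1 preact (dpreact t).
Proof.
have dM := is_deriveM_fun (is_derive_id t 1) (is_derive_savg T_gt0 al be ka t).
apply: is_derive_eq (is_deriveD_fun (is_derive_savg T_gt0 al be ga t) dM) _.
by rewrite mul1r.
Qed.

Lemma is_derive_dpreact (t : R) : is_derive t 1 dpreact (ddpreact t).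
Proof.
have dM := is_deriveM_fun (is_derive_id t 1) (is_derive_scov T_gt0 al be ka t).
have dD := is_deriveD_fun (is_derive_savg T_gt0 al be ka t) dM.
apply: is_derive_eq (is_deriveD_fun (is_derive_scov T_gt0 al be ga t) dD) _.
by rewrite mul1r.
Qed.

Variables N k b : R.
Hypotheses (N0 : 0 <= N) (k0 : 0 <= k) (b0 : 0 <= b).
Hypotheses (gaN : forall s, `|ga s| <= N) (kak : forall s, `|ka s| <= k)
  (beb : forall s, `|be s| <= b).

Lemma dpreact_le (t : R) : 0 <= t <= 1 ->
  `|dpreact t| <= 2 * (N * b) + k + 2 * (k * b).
Proof.
move=> /andP[t0 t1]; rewrite -addrA.
apply: (le_trans (ler_normD _ _)); rewrite lerD ?norm_scov_le//.
apply: (le_trans (ler_normD _ _)); rewrite lerD ?norm_savg_le//.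
rewrite normrM (ger0_norm t0).
by apply: le_trans (norm_scov_le T_gt0 (zt t) k0 b0 kak beb); rewrite ler_piMl.
Qed.

(** The constant 6 is 2 + 2 + 2: each of the three terms of the cumulant contains one covariance. *)
Let dscov_le t g (G : R) : 0 <= G -> (forall s, `|g s| <= G) ->
  `|dscov t g| <= 6 * (G * b ^+ 2).
Proof.
move=> G0 gG.
have -> : 6 * (G * b ^+ 2) = 2 * ((G * b) * b) + (2 * (G * b) * b + G * (2 * (b * b))).
  by ring.
apply: (le_trans (ler_normB _ _)); apply: lerD.
  by apply: norm_scov_le; rewrite ?mulr_ge0// => s; rewrite normrM ler_pM.
apply: (le_trans (ler_normD _ _)); apply: lerD; rewrite normrM ler_pM//.
- exact: norm_scov_le.
- exact: norm_savg_le.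
- exact: norm_savg_le.
- exact: norm_scov_le.
Qed.

Lemma ddpreact_le (t : R) : 0 <= t <= 1 ->
  `|ddpreact t| <= 6 * (N * b ^+ 2) + 4 * (k * b) + 6 * (k * b ^+ 2).
Proof.
move=> /andP[t0 t1].
have -> : 6 * (N * b ^+ 2) + 4 * (k * b) + 6 * (k * b ^+ 2) =
    6 * (N * b ^+ 2) + (2 * (k * b) + (2 * (k * b) + 6 * (k * b ^+ 2))) by ring.
apply: (le_trans (ler_normD _ _)); rewrite lerD ?dscov_le//.
apply: (le_trans (ler_normD _ _)); rewrite lerD ?norm_scov_le//.
apply: (le_trans (ler_normD _ _)); rewrite lerD ?norm_scov_le//.
rewrite normrM (ger0_norm t0).
by apply: le_trans (dscov_le t k0 kak); rewrite ler_piMl.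
Qed.

Variables (sig : R -> R) (s1 s2 : R).
Hypotheses (dsig : forall r : R, derivable sig r 1)
  (ddsig : forall r : R, derivable (derive1 sig) r 1).
Hypotheses (sig1 : forall r, `|derive1 sig r| <= s1)
  (sig2 : forall r, `|derive1 (derive1 sig) r| <= s2).

Lemma is_derive_derive1 (f : R -> R) (x : R) : derivable f x 1 ->
  is_derive x 1 f (derive1 f x).
Proof. by move=> fx; rewrite derive1E; exact: DeriveDef. Qed.

Lemma is_derive_sig_preact (t : R) :
  is_derive t 1 (fun t => sig (preact t)) (derive1 sig (preact t) * dpreact t).
Proof.
exact: (is_derive1_comp (is_derive_derive1 (@dsig (preact t))) (is_derive_preact t)).
Qed.

Lemma sig_preact_lipschitz :
  `|sig (preact 1) - sig (preact 0)| <= s1 * (2 * (N * b) + k + 2 * (k * b)).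
Proof.
have [c c01 ->] := @mean_value01 _ _ _ 1 ler01 is_derive_sig_preact.
by rewrite mulr1 normrM ler_pM// dpreact_le.
Qed.

Lemma sig_preact_remainder :
  `|sig (preact 1) - sig (preact 0) - derive1 sig (preact 0) * dpreact 0| <=
  s2 * (2 * (N * b) + k + 2 * (k * b)) ^+ 2
  + s1 * (6 * (N * b ^+ 2) + 4 * (k * b) + 6 * (k * b ^+ 2)).
Proof.
apply: (@second_order_remainder R (fun t => sig (preact t)) (fun t => derive1 sig (preact t) * dpreact t)
  (fun t => (derive1 (derive1 sig) (preact t) * dpreact t) * dpreact t
     + derive1 sig (preact t) * ddpreact t)).
- exact: is_derive_sig_preact.
- move=> t; apply: is_deriveM_fun (is_derive_dpreact t).
  exact: (is_derive1_comp (is_derive_derive1 (@ddsig (preact t))) (is_derive_preact t)).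
- move=> t t01; apply: (le_trans (ler_normD _ _)); apply: lerD.
    rewrite -mulrA normrM ler_pM// -expr2 normrX.
    by rewrite lerXn2r ?nnegrE ?dpreact_le// !addr_ge0 ?mulr_ge0.
  by rewrite normrM ler_pM// ddpreact_le.
Qed.

End Curve.

Section Neuron.
Variables (R : realType) (d T : nat) (q : dat R d T -> vec R d) (sig : R -> R).
Hypothesis T_gt0 : (0 < T)%N.
Implicit Types (X : dat R d T) (U u : vec R d) (W w : mat R d).

Definition dotcol X U : 'I_T -> R := fun t => \sum_k U k * X k t.

(** The directional derivative of a neuron at [(U, W)] along [(u, w)]. The covariance comes from
    moving the logits, the average from moving [U]; in this form linearity in [(u, w)] is
    visible. *)
Definition dneuron X U W u w : R :=
  derive1 sig (savg (scores q X W) (dotcol X U)) *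
  (scov (scores q X W) (dotcol X U) (scores q X w) + savg (scores q X W) (dotcol X u)).

Lemma dot_attn X U W : \sum_k U k * attn q X W k = savg (scores q X W) (dotcol X U).
Proof.
rewrite /savg /attn; under eq_bigr do rewrite mulr_sumr.
rewrite exchange_big; apply: eq_bigr => t _.
by rewrite mulr_suml; apply: eq_bigr => k _; rewrite mulrA.
Qed.

Lemma hneuronE X U W : hneuron q sig X U W = sig (savg (scores q X W) (dotcol X U)).
Proof. by rewrite /hneuron dot_attn. Qed.

Lemma scores_line X W w (t : R) :
  scores q X (fun k l => W k l + t * w k l) =
  (fun s => scores q X W s + t * scores q X w s).
Proof.
apply/funext => s; rewrite /scores mulr_sumr -big_split/=; apply: eq_bigr => k _.
rewrite mulrCA -mulrDr; congr (_ * _).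
by rewrite mulr_sumr -big_split/=; apply: eq_bigr => l _; rewrite mulrDl mulrA.
Qed.

Lemma dotcol_line X U u (t : R) :
  dotcol X (fun k => U k + t * u k) = (fun s => dotcol X U s + t * dotcol X u s).
Proof.
apply/funext => s; rewrite /dotcol mulr_sumr -big_split/=; apply: eq_bigr => k _.
by rewrite mulrDl mulrA.
Qed.

Lemma savg_line (z g h : 'I_T -> R) (t : R) :
  savg z (fun s => g s + t * h s) = savg z g + t * savg z h.
Proof.
rewrite /savg mulr_sumr -big_split/=; apply: eq_bigr => s _.
by rewrite mulrDl mulrA.
Qed.

Lemma scov_line (z g h1 h2 : 'I_T -> R) (t : R) :
  scov z g (fun s => h1 s + t * h2 s) = scov z g h1 + t * scov z g h2.
Proof.
rewrite /scov savg_line.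
have -> : (fun s => g s * (h1 s + t * h2 s)) = (fun s => g s * h1 s + t * (g s * h2 s)).
  by apply/funext => s; ring.
by rewrite savg_line; ring.
Qed.

(** This identifies a neuron restricted to a line with the one-variable curve studied above, so that
    its calculus transfers. *)
Lemma hneuron_line X U u W w (t : R) :
  hneuron q sig X (fun k => U k + t * u k) (fun k l => W k l + t * w k l) =
  sig (preact (scores q X W) (scores q X w) (dotcol X U) (dotcol X u) t).
Proof. by rewrite hneuronE scores_line dotcol_line savg_line. Qed.

Lemma dneuron_line X U W u1 u2 w1 w2 (t : R) :
  dneuron X U W (fun k => u1 k + t * u2 k) (fun k l => w1 k l + t * w2 k l) =
  dneuron X U W u1 w1 + t * dneuron X U W u2 w2.
Proof. by rewrite /dneuron scores_line dotcol_line savg_line scov_line; ring. Qed.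

Hypotheses (dsig : forall r : R, derivable sig r 1).

Lemma is_derive_hneuron X U u W w :
  is_derive (0 : R) 1
    (fun t => hneuron q sig X (fun k => U k + t * u k) (fun k l => W k l + t * w k l))
    (dneuron X U W u w).
Proof.
rewrite [X in is_derive _ _ X _](_ : _ = fun t => sig (preact (scores q X W)
   (scores q X w) (dotcol X U) (dotcol X u) t)); last first.
  by apply/funext => t; exact: hneuron_line.
apply: is_derive_eq (is_derive_sig_preact T_gt0 _ _ _ _ dsig 0) _.
have z0 : (fun s => scores q X W s + 0 * scores q X w s) = scores q X W.
  by apply/funext => s; rewrite mul0r addr0.
by rewrite /preact /dpreact z0 !mul0r !addr0.
Qed.

Variables (s1 s2 : R).
Hypotheses (ddsig : forall r : R, derivable (derive1 sig) r 1).
Hypotheses (sig1 : forall r, `|derive1 sig r| <= s1)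
  (sig2 : forall r, `|derive1 (derive1 sig) r| <= s2).
Variable X : dat R d T.
Hypotheses (X1 : in_Xset X) (q1 : norm2 (q X) <= 1).

Lemma norm_dotcol_le U t : `|dotcol X U t| <= norm2 U.
Proof.
apply: (le_trans (norm_dot_le U (fun k => X k t))).
by rewrite ler_piMr ?norm2_ge0//; exact: X1.
Qed.

Lemma norm_scores_le w t : `|scores q X w t| <= frob w.
Proof.
apply: (le_trans (norm_bilin_le (fun k => X k t) (q X) w)).
rewrite -[leRHS]mul1r ler_pM ?mulr_ge0 ?norm2_ge0 ?frob_ge0//; first exact: X1.
by rewrite ler_piMr ?frob_ge0.
Qed.

Lemma dneuron_le U W u w :
  `|dneuron X U W u w| <= s1 * (2 * (norm2 U * frob w) + norm2 u).
Proof.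
rewrite normrM ler_pM//; apply: (le_trans (ler_normD _ _)); rewrite lerD//.
  by apply: norm_scov_le; rewrite ?norm2_ge0 ?frob_ge0//;
    [exact: norm_dotcol_le|exact: norm_scores_le].
by apply: norm_savg_le => // t; exact: norm_dotcol_le.
Qed.

Let line1 U u W w : hneuron q sig X (fun k => U k + u k) (fun k l => W k l + w k l) =
  sig (preact (scores q X W) (scores q X w) (dotcol X U) (dotcol X u) 1).
Proof.
rewrite -hneuron_line; congr hneuron.
  by apply/funext => k; rewrite mul1r.
by apply/funext => k; apply/funext => l; rewrite mul1r.
Qed.

Let z0 W w : (fun s => scores q X W s + 0 * scores q X w s) = scores q X W.
Proof. by apply/funext => s; rewrite mul0r addr0. Qed.

Lemma hneuron_lipschitz U u W w :
  `|hneuron q sig X (fun k => U k + u k) (fun k l => W k l + w k l) - hneuron q sig X U W| <=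
  s1 * (2 * (norm2 U * frob w) + norm2 u + 2 * (norm2 u * frob w)).
Proof.
have := sig_preact_lipschitz T_gt0 (scores q X W) (norm2_ge0 U) (norm2_ge0 u) (frob_ge0 w)
  (norm_dotcol_le U) (norm_dotcol_le u) (norm_scores_le w) dsig sig1.
by rewrite -line1 /preact z0 mul0r addr0 -hneuronE.
Qed.

Lemma hneuron_remainder U u W w :
  `|hneuron q sig X (fun k => U k + u k) (fun k l => W k l + w k l) - hneuron q sig X U W
    - dneuron X U W u w| <=
  s2 * (2 * (norm2 U * frob w) + norm2 u + 2 * (norm2 u * frob w)) ^+ 2
  + s1 * (6 * (norm2 U * frob w ^+ 2) + 4 * (norm2 u * frob w)
          + 6 * (norm2 u * frob w ^+ 2)).
Proof.
have := sig_preact_remainder T_gt0 (scores q X W) (norm2_ge0 U) (norm2_ge0 u) (frob_ge0 w)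
  (norm_dotcol_le U) (norm_dotcol_le u) (norm_scores_le w) dsig ddsig sig1 sig2.
by rewrite -line1 /preact /dpreact z0 !mul0r !addr0 -hneuronE.
Qed.

End Neuron.

(** * Parameter space and coordinate gradients *)

Section ParamSpace.
Variables (R : realType) (d m : nat).
Implicit Types (x y z : param R d m) (D F : param R d m -> R).

Definition pzero : param R d m := Param (fun _ => 0) (fun _ _ => 0) (fun _ _ _ => 0).

Lemma param_ext x y : (forall i, pc x i = pc y i) -> (forall i k, pU x i k = pU y i k) ->
  (forall i k l, pW x i k l = pW y i k l) -> x = y.
Proof.
case: x y => [xc xU xW] [yc yU yW] /= ec eU eW; congr Param; apply/funext => i //.
  by apply/funext => k.
by apply/funext => k; apply/funext => l.
Qed.

(** Sums of parameters are bigops over the plain function [padd]; they are computed by projecting to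
    coordinates, here and in the two lemmas that follow. *)
Lemma pc_sum (I : Type) (r : seq I) (F : I -> param R d m) i :
  pc (\big[@padd R d m/pzero]_(s <- r) F s) i = \sum_(s <- r) pc (F s) i.
Proof. exact: (big_morph (fun p => pc p i)). Qed.

Lemma pU_sum (I : Type) (r : seq I) (F : I -> param R d m) i k :
  pU (\big[@padd R d m/pzero]_(s <- r) F s) i k = \sum_(s <- r) pU (F s) i k.
Proof. exact: (big_morph (fun p => pU p i k)). Qed.

Lemma pW_sum (I : Type) (r : seq I) (F : I -> param R d m) i k l :
  pW (\big[@padd R d m/pzero]_(s <- r) F s) i k l = \sum_(s <- r) pW (F s) i k l.
Proof. exact: (big_morph (fun p => pW p i k l)). Qed.

Definition base_c (i : 'I_m) : param R d m :=
  Param (fun i' => (i' == i)%:R) (fun _ _ => 0) (fun _ _ _ => 0).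
Definition base_U (i : 'I_m) (k : 'I_d) : param R d m :=
  Param (fun _ => 0) (fun i' k' => ((i' == i) && (k' == k))%:R) (fun _ _ _ => 0).
Definition base_W (i : 'I_m) (k l : 'I_d) : param R d m :=
  Param (fun _ => 0) (fun _ _ => 0)
    (fun i' k' l' => [&& i' == i, k' == k & l' == l]%:R).


Lemma sum_base_c z :
  \big[@padd R d m/pzero]_i pscale (pc z i) (base_c i) =
  Param (pc z) (fun _ _ => 0) (fun _ _ _ => 0).
Proof.
apply: param_ext => [i|i k|i k l].
- rewrite pc_sum (bigD1 i)//= eqxx mulr1 big1 ?addr0// => j ji.
  by rewrite /= eq_sym (negPf ji) mulr0.
- by rewrite pU_sum big1// => j _; rewrite /= mulr0.
- by rewrite pW_sum big1// => j _; rewrite /= mulr0.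
Qed.

Lemma sum_base_U z :
  \big[@padd R d m/pzero]_i \big[@padd R d m/pzero]_k pscale (pU z i k) (base_U i k) =
  Param (fun _ => 0) (pU z) (fun _ _ _ => 0).
Proof.
apply: param_ext => [i|i k|i k l].
- rewrite pc_sum big1// => j _.
  by rewrite pc_sum big1// => k _; rewrite /= mulr0.
- rewrite pU_sum (bigD1 i)//= pU_sum (bigD1 k)//= !eqxx mulr1 !big1 ?addr0//.
    move=> j ji; rewrite pU_sum big1// => k' _.
    by rewrite /= [i == j]eq_sym (negPf ji) mulr0.
  by move=> j jk; rewrite /= [k == j]eq_sym (negPf jk) ?andbF mulr0.
- rewrite pW_sum big1// => j _.
  by rewrite pW_sum big1// => k' _; rewrite /= mulr0.
Qed.

Lemma sum_base_W z :
  \big[@padd R d m/pzero]_i \big[@padd R d m/pzero]_k \big[@padd R d m/pzero]_l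
    pscale (pW z i k l) (base_W i k l) =
  Param (fun _ => 0) (fun _ _ => 0) (pW z).
Proof.
apply: param_ext => [i|i k|i k l].
- rewrite pc_sum big1// => j _; rewrite pc_sum big1// => k _.
  by rewrite pc_sum big1// => l _; rewrite /= mulr0.
- rewrite pU_sum big1// => j _; rewrite pU_sum big1// => k' _.
  by rewrite pU_sum big1// => l _; rewrite /= mulr0.
- rewrite pW_sum (bigD1 i)//= pW_sum (bigD1 k)//= pW_sum (bigD1 l)//=.
  rewrite !eqxx mulr1 !big1 ?addr0//.
  + move=> j ji; rewrite pW_sum big1// => k' _; rewrite pW_sum big1// => l' _.
    by rewrite /= [i == j]eq_sym (negPf ji) mulr0.
  + move=> j jk; rewrite pW_sum big1// => l' _.
    by rewrite /= [k == j]eq_sym (negPf jk) ?andbF mulr0.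
  + by move=> j jl; rewrite /= [l == j]eq_sym (negPf jl) ?andbF mulr0.
Qed.

(** One equation carries additivity and homogeneity, in the form in which points of a line are
    written. *)
Definition plinear D := forall x y (t : R), D (padd x (pscale t y)) = D x + t * D y.

Lemma plinear0 D : plinear D -> D pzero = 0.
Proof.
move=> lD; have := lD pzero pzero 1.
have -> : padd pzero (pscale 1 pzero) = pzero.
  by apply: param_ext => *; rewrite /= mul1r addr0.
by rewrite mul1r; lra.
Qed.

Lemma plinearD D x y : plinear D -> D (padd x y) = D x + D y.
Proof.
move=> lD; rewrite -[D y]mul1r -lD; congr D.
by apply: param_ext => *; rewrite /= mul1r.
Qed.

Lemma plinearZ D x (t : R) : plinear D -> D (pscale t x) = t * D x.
Proof.
move=> lD; rewrite -[RHS]add0r -[X in X + _](plinear0 lD) -lD; congr D.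
by apply: param_ext => *; rewrite /= add0r.
Qed.

Lemma plinear_sum D (I : Type) (r : seq I) (G : I -> param R d m) : plinear D ->
  D (\big[@padd R d m/pzero]_(s <- r) G s) = \sum_(s <- r) D (G s).
Proof.
move=> lD; apply: (big_morph D) => [x y|]; [exact: plinearD|exact: plinear0].
Qed.

Lemma plinear_pdot D z : plinear D ->
  D z = \sum_i (pc z i * D (base_c i) + \sum_k pU z i k * D (base_U i k)
                + \sum_k \sum_l pW z i k l * D (base_W i k l)).
Proof.
move=> lD.
have {1}-> : z = padd (padd (Param (pc z) (fun _ _ => 0) (fun _ _ _ => 0))
    (Param (fun _ => 0) (pU z) (fun _ _ _ => 0))) (Param (fun _ => 0) (fun _ _ => 0) (pW z)).
  by apply: param_ext => *; rewrite /= ?(addr0, add0r).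
rewrite -sum_base_c -sum_base_U -sum_base_W !(plinearD _ _ lD) !(plinear_sum _ _ lD).
rewrite -!big_split/=; apply: eq_bigr => i _.
rewrite (plinearZ _ _ lD) !(plinear_sum _ _ lD); congr (_ + _ + _).
  by apply: eq_bigr => k _; rewrite (plinearZ _ _ lD).
apply: eq_bigr => k _; rewrite (plinear_sum _ _ lD).
by apply: eq_bigr => l _; rewrite (plinearZ _ _ lD).
Qed.

(** Partial derivatives alone do not determine directional ones. Here all directional derivatives
    are given and depend linearly on the direction, so the entries of [pgrad] are the values of [D]
    on the basis parameters and the pairing recombines them. *)
Lemma pdot_pgrad F D x : plinear D ->
  (forall z, is_derive (0 : R) 1 (fun t => F (padd x (pscale t z))) (D z)) ->
  forall z, pdot (pgrad F x) z = D z.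
Proof.
move=> lD FD z; rewrite (plinear_pdot _ lD) /pdot; apply: eq_bigr => i _ /=.
have E y (c : R -> param R d m) : (forall t, c t = padd x (pscale t y)) ->
    derive1 (fun t => F (c t)) 0 = D y.
  move=> cE; rewrite -(is_derive1E (FD y)); congr derive1.
  by apply/funext => t; rewrite cE.
congr (_ + _ + _).
- rewrite mulrC; congr (_ * _); apply: E => t.
  by apply: param_ext => *; rewrite /= ?mulr0 ?addr0// mulrC.
- apply: eq_bigr => k _; rewrite mulrC; congr (_ * _); apply: E => t.
  by apply: param_ext => *; rewrite /= ?mulr0 ?addr0// mulrC.
- apply: eq_bigr => k _; apply: eq_bigr => l _; rewrite mulrC; congr (_ * _).
  by apply: E => t; apply: param_ext => *; rewrite /= ?mulr0 ?addr0// mulrC.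
Qed.

Lemma pdotDr w : plinear (pdot w).
Proof.
move=> x y t; rewrite /pdot mulr_sumr -big_split/=; apply: eq_bigr => i _.
have -> : \sum_k pU w i k * (pU x i k + t * pU y i k) =
    \sum_k pU w i k * pU x i k + t * \sum_k pU w i k * pU y i k.
  by rewrite mulr_sumr -big_split; apply: eq_bigr => k _ /=; ring.
have -> : \sum_k \sum_l pW w i k l * (pW x i k l + t * pW y i k l) =
    \sum_k \sum_l pW w i k l * pW x i k l + t * \sum_k \sum_l pW w i k l * pW y i k l.
  rewrite mulr_sumr -big_split; apply: eq_bigr => k _ /=.
  by rewrite mulr_sumr -big_split; apply: eq_bigr => l _ /=; ring.
by ring.
Qed.

Lemma pdotC x y : pdot x y = pdot y x.
Proof.
apply: eq_bigr => i _; congr (_ + _ + _); first exact: mulrC.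
  by apply: eq_bigr => k _; exact: mulrC.
by apply: eq_bigr => k _; apply: eq_bigr => l _; exact: mulrC.
Qed.

Lemma pdot_sqr x :
  pdot x x = \sum_i (pc x i ^+ 2 + norm2 (pU x i) ^+ 2 + frob (pW x i) ^+ 2).
Proof. by apply: eq_bigr => i _; rewrite sqr_norm2 sqr_frob. Qed.

Lemma pdot_ge0 x : 0 <= pdot x x.
Proof.
by rewrite pdot_sqr sumr_ge0// => i _; rewrite !addr_ge0// sqr_ge0.
Qed.

End ParamSpace.

(** * Model derivative and projected steps *)

Section ModelDerivative.
Variables (R : realType) (d T m n : nat) (q : dat R d T -> vec R d) (sig : R -> R).
Hypothesis T_gt0 : (0 < T)%N.
Hypothesis dsig : forall r : R, derivable sig r 1.
Implicit Types (x z : param R d m) (X : dat R d T).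

Definition dmodel x X z : R := (Num.sqrt m%:R)^-1 *
  \sum_i (pc z i * hneuron q sig X (pU x i) (pW x i)
          + pc x i * dneuron q sig X (pU x i) (pW x i) (pU z i) (pW z i)).

Lemma plinear_dmodel x X : plinear (dmodel x X).
Proof.
move=> y z t; rewrite /dmodel mulrCA -mulrDr [t * \sum_(i < _) _]mulr_sumr -big_split/=.
congr (_ * _); apply: eq_bigr => i _.
by rewrite dneuron_line; ring.
Qed.

Lemma is_derive_model x X z :
  is_derive (0 : R) 1 (fun t => model q sig (padd x (pscale t z)) X) (dmodel x X z).
Proof.
apply: is_deriveZ_fun; apply: is_derive_sum_fun => i.
have dc : is_derive (0 : R) 1 (fun t => pc x i + t * pc z i) (pc z i).
  exact: is_derive_affine.
have dh := is_derive_hneuron q T_gt0 dsig X (pU x i) (pU z i) (pW x i) (pW z i).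
apply: is_derive_eq (is_deriveM_fun dc dh) _.
rewrite mul0r addr0; congr (_ * _ + _).
congr hneuron; first by apply/funext => k; rewrite mul0r addr0.
by apply/funext => k; apply/funext => l; rewrite mul0r addr0.
Qed.

Lemma pdot_pgrad_model x X z :
  pdot (pgrad (fun p => model q sig p X) x) z = dmodel x X z.
Proof.
by apply: pdot_pgrad => [|y]; [exact: plinear_dmodel|exact: is_derive_model].
Qed.

Variables (Xs : 'I_n -> dat R d T) (ys : 'I_n -> R).

Lemma pdot_pgrad_loss x z : pdot (pgrad (loss q sig Xs ys) x) z =
  n%:R^-1 * \sum_j 2 * (model q sig x (Xs j) - ys j) * dmodel x (Xs j) z.
Proof.
apply: (@pdot_pgrad _ _ _ _ (fun z => n%:R^-1 *
    \sum_j 2 * (model q sig x (Xs j) - ys j) * dmodel x (Xs j) z)) => [y w t|{}z].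
  rewrite mulrCA -mulrDr [t * \sum_(i < _) _]mulr_sumr -big_split/=; congr (_ * _).
  by apply: eq_bigr => j _; rewrite plinear_dmodel; ring.
apply: is_deriveZ_fun; apply: is_derive_sum_fun => j.
have dr := is_deriveD_fun (is_derive_model x (Xs j) z) (is_derive_cst (- ys j) (0 : R) 1).
apply: is_derive_eq (is_deriveM_fun dr dr) _.
have -> : padd x (pscale 0 z) = x by apply: param_ext => *; rewrite /= mul0r addr0.
by rewrite /cst /=; ring.
Qed.

End ModelDerivative.

Section L2Norm.
Variable R : realType.

(** The index type is arbitrary so that scalars (over ['I_1]), vectors and matrices (over pairs)
    share one triangle inequality. *)
Definition l2 (I : finType) (a : I -> R) : R := Num.sqrt (\sum_i a i ^+ 2).

Lemma l2_triangle (I : finType) (a b : I -> R) : l2 (fun i => a i + b i) <= l2 a + l2 b.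
Proof.
have a0 : 0 <= l2 a := sqrtr_ge0 _. have b0 : 0 <= l2 b := sqrtr_ge0 _.
have s0 (c : I -> R) : 0 <= \sum_i c i ^+ 2.
  by rewrite sumr_ge0// => i _; exact: sqr_ge0.
rewrite -[leRHS]ger0_norm ?addr_ge0// -sqrtr_sqr ler_wsqrtr// sqrrD !sqr_sqrtr//.
have ab : `|\sum_i a i * b i| <= l2 a * l2 b.
  by rewrite -sqrtrM ?ler_sqrt_sqr ?cauchy_schwarz_sum.
have -> : \sum_i (a i + b i) ^+ 2 =
    \sum_i a i ^+ 2 + \sum_i a i * b i *+ 2 + \sum_i b i ^+ 2.
  by rewrite -!big_split; apply: eq_bigr => i _ /=; rewrite sqrrD.
rewrite sumrMnl lerD2r lerD2l lerMn2r/=.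
exact: le_trans (ler_norm _) ab.
Qed.

Lemma l2Z (I : finType) (a : I -> R) (t : R) : l2 (fun i => t * a i) = `|t| * l2 a.
Proof.
rewrite /l2; under eq_bigr do rewrite exprMn.
by rewrite -mulr_sumr sqrtrM ?sqr_ge0// sqrtr_sqr.
Qed.

Lemma frobE d (w : mat R d) : frob w = l2 (fun p : 'I_d * 'I_d => w p.1 p.2).
Proof. by rewrite /frob /l2 pair_big. Qed.

Lemma l2_convex (I : finType) (a b : I -> R) (t r : R) : 0 <= t <= 1 ->
  l2 a <= r -> l2 b <= r -> l2 (fun i => a i + t * (b i - a i)) <= r.
Proof.
move=> /andP[t0 t1] ar br.
have -> : (fun i => a i + t * (b i - a i)) = (fun i => (1 - t) * a i + t * b i).
  by apply/funext => i; ring.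
apply: (le_trans (l2_triangle _ _)); rewrite !l2Z !ger0_norm ?subr_ge0//.
have -> : r = (1 - t) * r + t * r by ring.
by rewrite lerD// ler_wpM2l// subr_ge0.
Qed.

Lemma l2_sub (I : finType) (a b : I -> R) (r : R) :
  l2 a <= r -> l2 b <= r -> l2 (fun i => a i - b i) <= 2 * r.
Proof.
move=> ar br.
have -> : (fun i => a i - b i) = (fun i => a i + -1 * b i).
  by apply/funext => i; rewrite mulN1r.
by apply: (le_trans (l2_triangle _ _)); rewrite l2Z normrN1 mul1r mulr_natl mulr2n lerD.
Qed.

End L2Norm.

Section ProjectedStep.
Variables (R : realType) (d m : nat).
Implicit Types (x y z g p : param R d m).

Lemma pdot_line x y (t : R) :
  pdot (padd x (pscale t y)) (padd x (pscale t y)) =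
  pdot x x + 2 * t * pdot x y + t ^+ 2 * pdot y y.
Proof.
by rewrite (pdotDr (padd x _)) [pdot _ x]pdotC [pdot _ y]pdotC !pdotDr [pdot y x]pdotC; ring.
Qed.

(** Minimality along the segment from [p] to [z] makes a quadratic nonnegative on [0, 1], which
    forces [pdot a b >= 0]; expanding the square of [a + b] then gives the claim. Only segments
    issued from [p] are needed. *)
Lemma projection_nonexpansive (A : param R d m -> Prop) y p z :
  (forall t, 0 <= t <= 1 -> A (padd p (pscale t (psub z p)))) ->
  (forall z, A z -> pdist2 p y <= pdist2 z y) -> pdist2 z p <= pdist2 z y.
Proof.
move=> Aseg pmin; set a := psub p y; set b := psub z p.
have quad t : 0 <= t <= 1 -> 0 <= 2 * t * pdot a b + t ^+ 2 * pdot b b.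
  move=> /Aseg/pmin; rewrite /pdist2.
  have -> : psub (padd p (pscale t (psub z p))) y = padd a (pscale t b).
    by apply: param_ext => *; rewrite /=; ring.
  by rewrite pdot_line -/a; lra.
have b0 : 0 <= pdot b b := pdot_ge0 b.
have ab : 0 <= pdot a b.
  rewrite leNgt; apply/negP => ab0.
  (* This [t] lies in (0, 1] whatever the size of [pdot b b], including 0, and makes
     [2 * pdot a b + t * pdot b b] equal to [(1 + t) * pdot a b], which is negative. *)
  set t := - pdot a b / (pdot b b - pdot a b).
  have den : 0 < pdot b b - pdot a b by lra.
  have t0 : 0 < t by rewrite divr_gt0//; lra.
  have t1 : t <= 1 by rewrite ler_pdivrMr//; lra.
  have /quad : 0 <= t <= 1 by rewrite ltW.
  have -> : 2 * t * pdot a b + t ^+ 2 * pdot b b = t * (2 * pdot a b + t * pdot b b).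
    by ring.
  rewrite pmulr_rge0// => h.
  have tE : t * (pdot b b - pdot a b) = - pdot a b by rewrite /t divfK// gt_eqF.
  nra.
rewrite /pdist2 -/b.
have -> : psub z y = padd a (pscale 1 b).
  by apply: param_ext => *; rewrite /=; ring.
rewrite pdot_line; have := pdot_ge0 a; lra.
Qed.

Lemma pdist2_step x g z (eta : R) :
  pdist2 z (psub x (pscale eta g)) =
  pdist2 z x + 2 * eta * pdot g (psub z x) + eta ^+ 2 * pdot g g.
Proof.
rewrite /pdist2.
have -> : psub z (psub x (pscale eta g)) = padd (psub z x) (pscale eta g).
  by apply: param_ext => *; rewrite /=; ring.
by rewrite pdot_line [pdot _ g]pdotC.
Qed.

Lemma pgd_regret (phi g : nat -> param R d m) z (eta : R) :
  (forall s, pdist2 z (phi s.+1) <= pdist2 z (psub (phi s) (pscale eta (g s)))) ->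
  forall tau, 2 * eta * \sum_(s < tau) pdot (g s) (psub (phi s) z)
    <= pdist2 z (phi 0%N) + eta ^+ 2 * \sum_(s < tau) pdot (g s) (g s).
Proof.
move=> step tau.
(* The distance at time [tau] is kept for the telescoping induction and dropped only afterwards. *)
suff : 2 * eta * \sum_(s < tau) pdot (g s) (psub (phi s) z) + pdist2 z (phi tau)
    <= pdist2 z (phi 0%N) + eta ^+ 2 * \sum_(s < tau) pdot (g s) (g s).
  by have : 0 <= pdist2 z (phi tau) := pdot_ge0 _; lra.
elim: tau => [|t IH]; first by rewrite !big_ord0 !mulr0 add0r addr0.
have := step t; rewrite !big_ord_recr/= pdist2_step.
have -> : psub z (phi t) = padd (pzero R d m) (pscale (-1) (psub (phi t) z)).
  by apply: param_ext => *; rewrite /=; ring.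
rewrite (pdotDr (g t)).
have -> : pdot (g t) (pzero R d m) = 0 by apply: plinear0; exact: pdotDr.
lra.
Qed.

Lemma in_Omega_segment (rc ru rw : R) x0 x y (t : R) : 0 <= t <= 1 ->
  in_Omega rc ru rw x0 x -> in_Omega rc ru rw x0 y ->
  in_Omega rc ru rw x0 (padd x (pscale t (psub y x))).
Proof.
move=> t01 xO yO i; have [xc [xU xW]] := xO i; have [yc [yU yW]] := yO i.
split; [|split].
- have E (a : R) : `|a| = l2 (fun _ : 'I_1 => a) by rewrite /l2 big_ord1 sqrtr_sqr.
  rewrite E (_ : (fun=> _) = fun _ : 'I_1 =>
    (pc x i - pc x0 i) + t * ((pc y i - pc x0 i) - (pc x i - pc x0 i))).
    by apply: l2_convex => //; rewrite -E.
  by apply/funext => _ /=; ring.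
- rewrite (_ : (fun k => _) = fun k : 'I_d =>
    (pU x i k - pU x0 i k) + t * ((pU y i k - pU x0 i k) - (pU x i k - pU x0 i k))).
    exact: l2_convex.
  by apply/funext => k /=; ring.
- rewrite frobE (_ : (fun e => _) = fun e : 'I_d * 'I_d =>
    (pW x i e.1 e.2 - pW x0 i e.1 e.2)
    + t * ((pW y i e.1 e.2 - pW x0 i e.1 e.2) - (pW x i e.1 e.2 - pW x0 i e.1 e.2))).
    by apply: l2_convex => //; rewrite -(frobE (fun k l => _ k l - _ k l)).
  by apply/funext => e /=; ring.
Qed.

Definition pmean (phi : nat -> param R d m) (tau : nat) : param R d m :=
  pscale (tau%:R^-1) (\big[@padd R d m/pzero R d m]_(s < tau) phi s).

(** The new mean lies on the segment from the old mean to the new iterate, so two-point convexity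
    suffices to keep means in the set. *)
Lemma pmeanS (phi : nat -> param R d m) (t : nat) : (0 < t)%N ->
  pmean phi t.+1 =
  padd (pmean phi t) (pscale (t.+1%:R^-1) (psub (phi t) (pmean phi t))).
Proof.
move=> t0; have tn : (t%:R : R) != 0 by rewrite pnatr_eq0 -lt0n.
have tn1 : (t%:R : R) + 1 != 0 by rewrite natr1 pnatr_eq0.
by apply: param_ext => *; rewrite /= ?(pc_sum, pU_sum, pW_sum) big_ord_recr/= -natr1; field;
  rewrite tn tn1.
Qed.

Lemma in_Omega_pmean (rc ru rw : R) x0 (phi : nat -> param R d m) (tau : nat) :
  (forall s, in_Omega rc ru rw x0 (phi s)) -> (0 < tau)%N ->
  in_Omega rc ru rw x0 (pmean phi tau).
Proof.
move=> phiO; elim: tau => // -[_ _|t /(_ isT) IH _].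
  (* The induction starts at one iterate: the mean of no iterates is [pzero], which may lie outside
     the set. *)
  have -> : pmean phi 1 = phi 0%N; last exact: phiO.
  by apply: param_ext => *;
    rewrite /= ?(pc_sum, pU_sum, pW_sum) big_ord_recr/= big_ord0 add0r invr1 mul1r.
rewrite pmeanS//; apply: in_Omega_segment => //.
by rewrite invr_ge0 ler0n invf_le1 ?ltr0n// ler1n.
Qed.

End ProjectedStep.

(** * Size of the targets *)

Section TargetBound.
Variable R : realType.

(** The predicate [S] selects the coordinates on which the quadratic bound depends. With only the
    entries of [U] selected, the result grows with [d] and not with [d + d * d]. *)
Lemma norm_gaussE_le (k : nat) (S : pred nat) (a b : R) (g : (nat -> R) -> R) :
  0 <= a -> 0 <= b ->
  (forall z, `|g z| <= a + b * \sum_(j < k | S j) z j ^+ 2) ->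
  `|gaussE k g| <= a + m2bound R * b * \sum_(j < k | S j) 1.
Proof.
move=> a0 b0; elim: k a a0 g => [|k IH] a a0 g gle /=.
  by have := gle (fun=> 0); rewrite !big_ord0 !mulr0.
pose u (c : R) : R := if S k then c else 0.
have splitS (F : nat -> R) :
    \sum_(j < k.+1 | S j) F j = \sum_(j < k | S j) F j + u (F k).
  by rewrite big_mkcond big_ord_recr/= -big_mkcond.
rewrite (splitS (fun=> 1)).
have u1 : 0 <= u 1 by rewrite /u; case: (S k).
have s0 (F : nat -> R) : (forall j, 0 <= F j) -> 0 <= \sum_(j < k | S j) F j.
  by move=> F0; apply: sumr_ge0.
have -> : a + m2bound R * b * (\sum_(j < k | S j) 1 + u 1) =
    (a + m2bound R * b * \sum_(j < k | S j) 1) + m2bound R * (b * u 1) by ring.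
apply: normal_Rintegral_le.
- by rewrite addr_ge0// mulr_ge0 ?(s0 (fun=> 1))// mulr_ge0 ?m2bound_ge0.
- exact: mulr_ge0.
(* With [x] fixed, the square of the outermost coordinate is a constant for the inner integral and
   joins [a]; hence the generalization over [a]. *)
- move=> x; rewrite -addrA [X in a + X]addrC addrA.
  apply: IH => [|z].
    by apply: addr_ge0 => //; apply: mulr_ge0; [exact: mulr_ge0|exact: sqr_ge0].
  apply: (le_trans (gle _)).
  rewrite (splitS (fun j => (if j == k then x else z j) ^+ 2)) eqxx.
  have -> : u (x ^+ 2) = u 1 * x ^+ 2 by rewrite /u; case: (S k); rewrite ?mul1r ?mul0r.
  have -> : \sum_(j < k | S j) (if j == k :> nat then x else z j) ^+ 2 =
      \sum_(j < k | S j) z j ^+ 2.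
    by apply: eq_bigr => j _; rewrite ltn_eqF.
  by rewrite le_eqVlt; apply/orP; left; apply/eqP; ring.
Qed.

Lemma norm_initE_le d (F : R -> vec R d -> mat R d -> R) (a b : R) :
  0 <= a -> 0 <= b -> (forall c U W, `|F c U W| <= a + b * norm2 U ^+ 2) ->
  `|initE F| <= a + m2bound R * b * d%:R.
Proof.
move=> a0 b0 Fle; rewrite /initE !big_cons big_nil addr0.
pose G c : R := gaussE (d + d * d) (fun z => F c (fun k => z (k : nat))
  (fun k l => z (d + k * d + l)%N)).
have Gle c : `|G c| <= a + m2bound R * b * d%:R.
  have dE (f : nat -> R) :
      \sum_(j < d + d * d | (j < d)%N) f j = \sum_(j < d) f j.
    by rewrite -(big_ord_widen _ f) ?leq_addr.
  have -> : d%:R = \sum_(j < d + d * d | (j < d)%N) (1 : R).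
    by rewrite (dE (fun=> 1)) sumr_const card_ord.
  apply: (@norm_gaussE_le _ (fun j => j < d)%N) => // z.
  by rewrite (dE (fun j => z j ^+ 2)) -sqr_norm2; exact: Fle.
have := ler_normD (G 1) (G (-1)); have := Gle 1; have := Gle (-1).
rewrite -/(G 1) -/(G (-1)) normrM ger0_norm ?invr_ge0//; lra.
Qed.

Variables (d T : nat) (q : dat R d T -> vec R d) (sig : R -> R).
Hypotheses (d_gt0 : (0 < d)%N) (T_gt0 : (0 < T)%N).
Variables (s0 s1 nc nu nw : R).
Hypotheses (s00 : 0 <= s0) (s10 : 0 <= s1) (nc0 : 0 <= nc) (nu0 : 0 <= nu) (nw0 : 0 <= nw).
Hypotheses (sig0 : forall r, `|sig r| <= s0) (sig1 : forall r, `|derive1 sig r| <= s1).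
Variables (vc : R -> vec R d -> mat R d -> R) (vu : R -> vec R d -> mat R d -> vec R d)
  (vw : R -> vec R d -> mat R d -> mat R d).
Hypotheses (vcb : forall c U W, `|vc c U W| <= nc)
  (vub : forall c U W, norm2 (vu c U W) <= nu)
  (vwb : forall c U W, frob (vw c U W) <= nw).
Variable X : dat R d T.
Hypotheses (X1 : in_Xset X) (q1 : norm2 (q X) <= 1).

Lemma norm_phi_u_le (U v : vec R d) (W : mat R d) :
  `|\sum_k phi_u q sig X U W k * v k| <= s1 * norm2 v.
Proof.
have -> : \sum_k phi_u q sig X U W k * v k =
    derive1 sig (\sum_k U k * attn q X W k) * savg (scores q X W) (dotcol X v).
  by rewrite -dot_attn mulr_sumr; apply: eq_bigr => k _; rewrite /phi_u; ring.
rewrite normrM ler_pM//; apply: norm_savg_le => // t; exact: norm_dotcol_le.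
Qed.

(** The softmax Jacobian is the covariance matrix of the Gibbs weights: its diagonal part yields the
    average of the product, its rank-one part the product of the averages. *)
Lemma dot_Mmat (U : vec R d) (W w : mat R d) :
  \sum_k \sum_l (\sum_j Mmat q X W k j * U j) * q X l * w k l =
  scov (scores q X W) (scores q X w) (dotcol X U).
Proof.
transitivity (\sum_t \sum_s softmax_jac (scores q X W) t s * (scores q X w t * dotcol X U s)).
  transitivity (\sum_k \sum_t \sum_s softmax_jac (scores q X W) t s * dotcol X U s
      * (X k t * \sum_l w k l * q X l)).
    apply: eq_bigr => k _.
    transitivity ((\sum_j Mmat q X W k j * U j) * \sum_l w k l * q X l).
      by rewrite mulr_sumr; apply: eq_bigr => l _; ring.
    have -> : \sum_j Mmat q X W k j * U j =
        \sum_t \sum_s X k t * softmax_jac (scores q X W) t s * dotcol X U s.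
      rewrite /Mmat; under eq_bigr do rewrite mulr_suml.
      rewrite exchange_big; apply: eq_bigr => t _.
      under eq_bigr do rewrite mulr_suml.
      rewrite exchange_big; apply: eq_bigr => s _.
      by rewrite /dotcol mulr_sumr; apply: eq_bigr => j _; ring.
    rewrite mulr_suml; apply: eq_bigr => t _.
    by rewrite mulr_suml; apply: eq_bigr => s _; ring.
  rewrite exchange_big; apply: eq_bigr => t _.
  rewrite exchange_big; apply: eq_bigr => s _.
  by rewrite /scores -mulr_sumr; ring.
rewrite /scov.
have -> : savg (scores q X W) (fun t => scores q X w t * dotcol X U t) =
  \sum_t \sum_s (t == s)%:R * softmax (scores q X W) t * (scores q X w t * dotcol X U s).
  apply: eq_bigr => t _; rewrite (bigD1 t)//= eqxx mul1r big1 ?addr0 1?mulrC//.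
  by move=> s st; rewrite eq_sym (negPf st) !mul0r.
rewrite {2}/savg mulr_suml -sumrB; apply: eq_bigr => t _.
rewrite /savg mulr_sumr -sumrB; apply: eq_bigr => s _.
by rewrite /softmax_jac; ring.
Qed.

Lemma norm_phi_w_le (U : vec R d) (W v : mat R d) :
  `|\sum_k \sum_l phi_w q sig X U W k l * v k l| <= 2 * s1 * frob v * norm2 U.
Proof.
have -> : \sum_k \sum_l phi_w q sig X U W k l * v k l =
    derive1 sig (\sum_k U k * attn q X W k) * scov (scores q X W) (scores q X v) (dotcol X U).
  rewrite -dot_Mmat mulr_sumr; apply: eq_bigr => k _.
  by rewrite mulr_sumr; apply: eq_bigr => l _; rewrite /phi_w; ring.
rewrite normrM.
have -> : 2 * s1 * frob v * norm2 U = s1 * (2 * (frob v * norm2 U)) by ring.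
rewrite ler_pM//; apply: norm_scov_le; rewrite ?norm2_ge0 ?frob_ge0// => t.
  exact: norm_scores_le.
exact: norm_dotcol_le.
Qed.

(* AM-GM: [norm2 U <= (d + norm2 U ^ 2) / (2 sqrt d)], so that only second
   moments of the Gaussian weights are needed. *)
Lemma norm_ftilde_le :
  `|ftilde q sig vc vu vw X| <=
  s0 * nc + s1 * nu + s1 * nw * (1 + m2bound R) * Num.sqrt d%:R.
Proof.
set r := Num.sqrt d%:R : R.
have r0 : 0 < r by rewrite sqrtr_gt0 ltr0n.
have r2 : r ^+ 2 = d%:R by rewrite sqr_sqrtr// ler0n.
apply: (le_trans (ler_normD _ _)); apply: lerD.
  apply: (le_trans (ler_normD _ _)); apply: lerD.
    have := @norm_initE_le d (fun c U W => phi_c q sig X U W * vc c U W) (s0 * nc) 0.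
    rewrite mulr0 mul0r addr0; apply; rewrite ?mulr_ge0// => c U W.
    by rewrite mul0r addr0 normrM; apply: ler_pM => //; exact: sig0.
  have := @norm_initE_le d (fun c U W => \sum_k phi_u q sig X U W k * vu c U W k) (s1 * nu) 0.
  rewrite mulr0 mul0r addr0; apply; rewrite ?mulr_ge0// => c U W.
  by rewrite mul0r addr0 (le_trans (norm_phi_u_le _ _ _))// ler_wpM2l.
have -> : s1 * nw * (1 + m2bound R) * r =
    s1 * nw * r + m2bound R * (s1 * nw / r) * d%:R.
  by rewrite -r2; field; rewrite gt_eqF.
apply: norm_initE_le => [||c U W].
- by rewrite !mulr_ge0// ltW.
- by rewrite !mulr_ge0// invr_ge0 ltW.
apply: (le_trans (norm_phi_w_le _ _ _)).
have -> : s1 * nw * r + s1 * nw / r * norm2 U ^+ 2 =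
    s1 * nw * ((r ^+ 2 + norm2 U ^+ 2) / r) by field; rewrite gt_eqF.
have -> : 2 * s1 * frob (vw c U W) * norm2 U = s1 * frob (vw c U W) * (2 * norm2 U) by ring.
apply: ler_pM; rewrite ?mulr_ge0 ?frob_ge0 ?norm2_ge0// ?ler_wpM2l//.
by rewrite ler_pdivlMr//; have := sqr_ge0 (r - norm2 U); nra.
Qed.

End TargetBound.

(** * Bounds on the projection set *)

(** Neurons [i] and [i + m/2] share their weights and have opposite signs. Without this cancellation
    the initial output could be of order [sqrt m], and residuals would not be O(L1). *)
Lemma model_sym_init (R : realType) (d T m : nat) (q : dat R d T -> vec R d) (sig : R -> R)
    (phi0 : param R d m) (X : dat R d T) :
  ~~ odd m -> sym_init phi0 -> model q sig phi0 X = 0.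
Proof.
move=> m_even [_ sym].
have mE : m = (m./2 + m./2)%N.
  by rewrite addnn -[LHS]odd_double_half (negPf m_even).
(* The half is abstracted to a variable because [m./2] mentions [m], which is about to be
   substituted. *)
have [k mk] : exists k, m = (k + k)%N by exists m./2.
subst m; rewrite /model big_split_ord/= -big_split/= big1 ?mulr0// => i _.
have [|-> [-> ->]] := sym (lshift k i) (rshift k i).
  by rewrite /= addnn doubleK addnC.
by rewrite mulNr subrr.
Qed.

Section OmegaBounds.
Variables (R : realType) (d T m : nat) (q : dat R d T -> vec R d) (sig : R -> R).
Hypotheses (T_gt0 : (0 < T)%N) (m_gt0 : (0 < m)%N).
Hypothesis dsig : forall r : R, derivable sig r 1.
Hypothesis ddsig : forall r : R, derivable (derive1 sig) r 1.
Variables (s0 s1 s2 rc ru rw S : R).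
Hypotheses (s0_gt0 : 0 < s0) (s1_gt0 : 0 < s1) (s2_gt0 : 0 < s2).
Hypotheses (rc_gt0 : 0 < rc) (ru_gt0 : 0 < ru) (rw_gt0 : 0 < rw) (S_ge1 : 1 <= S).
Hypotheses (sig0 : forall r, `|sig r| <= s0) (sig1 : forall r, `|derive1 sig r| <= s1)
  (sig2 : forall r, `|derive1 (derive1 sig) r| <= s2).
Variable phi0 : param R d m.
Local Notation Om := (in_Omega rc ru rw phi0).
Local Notation rm := ((Num.sqrt (m%:R : R))^-1).
Hypothesis c_le : forall x i, Om x -> `|pc x i| <= 1 + rc.
Hypothesis U_le : forall x i, Om x -> norm2 (pU x i) <= S.
Variable X : dat R d T.
Hypotheses (X1 : in_Xset X) (q1 : norm2 (q X) <= 1).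
Implicit Types (x y z : param R d m).

Let rm_gt0 : 0 < rm. Proof. by rewrite invr_gt0 sqrtr_gt0 ltr0n. Qed.
Let S_ge0 : 0 <= S. Proof. exact: le_trans ler01 S_ge1. Qed.
Let rm_le1 : rm <= 1.
Proof. by rewrite invf_le1 ?sqrtr_gt0 ?ltr0n// -[leLHS]sqrtr1 ler_wsqrtr// ler1n. Qed.
Let rm2 : rm ^+ 2 * m%:R = 1.
Proof. by rewrite exprVn sqr_sqrtr ?ler0n// mulVf// pnatr_eq0 -lt0n. Qed.

(** Both points are compared through the center, which doubles each radius. *)
Lemma Omega_sub x y i : Om x -> Om y ->
  [/\ `|pc (psub y x) i| <= 2 * (rc * rm), norm2 (pU (psub y x) i) <= 2 * (ru * rm)
    & frob (pW (psub y x) i) <= 2 * (rw * rm)].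
Proof.
move=> xO yO; have [xc [xU xW]] := xO i; have [yc [yU yW]] := yO i; split.
- have -> : pc (psub y x) i = (pc y i - pc phi0 i) - (pc x i - pc phi0 i) by rewrite /=; ring.
  by rewrite (le_trans (ler_normB _ _))// mulr_natl mulr2n lerD.
- have -> : pU (psub y x) i =
      (fun k => (pU y i k - pU phi0 i k) - (pU x i k - pU phi0 i k)).
    by apply/funext => k /=; ring.
  exact: l2_sub.
- rewrite !frobE in xW yW *.
  rewrite (_ : (fun p => _) = fun e : 'I_d * 'I_d =>
     (pW y i e.1 e.2 - pW phi0 i e.1 e.2) - (pW x i e.1 e.2 - pW phi0 i e.1 e.2)).
    exact: l2_sub.
  by apply/funext => e /=; ring.
Qed.

(* [Kfst] and [Ksnd] bound the first and second derivatives of a pre-activation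
   along a segment of the projection set, in units of S / sqrt m and S / m. *)
Definition Kfst : R := 4 * rw + 2 * ru + 8 * (ru * rw).
Definition Ksnd : R := 24 * rw ^+ 2 + 16 * (ru * rw) + 48 * (ru * rw ^+ 2).
(** In [Krem], [1 + rc] bounds an outer weight multiplying the remainder of a neuron, and
    [2 * rc * Kfst] is the product of the change of that weight with the first-order change of the
    neuron. The quotients [s0 / s1] below express bounds by [s0] in units of [L1 = s1 * S]. *)
Definition Krem : R := (1 + rc) * (Kfst ^+ 2 + Ksnd) + 2 * rc * Kfst.
Definition Kgrad : R := s0 / s1 + 2 * (1 + rc).
Definition Kmod : R := 2 * rc * s0 / s1 + (1 + rc) * Kfst.

Lemma Kfst_ge0 : 0 <= Kfst.
Proof. by rewrite /Kfst !addr_ge0 ?mulr_ge0// ltW. Qed.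

Lemma Ksnd_ge0 : 0 <= Ksnd.
Proof. by rewrite /Ksnd !addr_ge0 ?mulr_ge0 ?exprn_ge0// ltW. Qed.

Lemma Krem_ge0 : 0 <= Krem.
Proof.
have rc0 := ltW rc_gt0; have F0 := Kfst_ge0; have G0 := Ksnd_ge0.
rewrite /Krem; move: Kfst Ksnd F0 G0 => F G F0 G0.
by rewrite addr_ge0 ?mulr_ge0 ?addr_ge0 ?sqr_ge0.
Qed.

(** [N], [k], [b] stand for the norms of [U] and of the increments of [U] and [W]. The term [k],
    which has no factor [N], is absorbed by [1 <= S], and the spare factor [rm] of [k * b] by
    [rm <= 1]. *)
Let first_order_le (N k b : R) : 0 <= N <= S -> 0 <= k <= 2 * (ru * rm) ->
  0 <= b <= 2 * (rw * rm) -> 2 * (N * b) + k + 2 * (k * b) <= rm * S * Kfst.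
Proof.
move=> /andP[N0 NS] /andP[k0 kr] /andP[b0 br].
have Nb : N * b <= S * (2 * (rw * rm)) by rewrite ler_pM.
have kb : k * b <= (2 * (ru * rm)) * (2 * (rw * rm)) by rewrite ler_pM.
have h0 : 0 <= ru * rm by rewrite mulr_ge0// ltW.
have h1 : ru * rm <= ru * rm * S by rewrite ler_peMr.
have h2 : (ru * rm) * (rw * rm) <= (ru * rm * S) * rw.
  apply: ler_pM => //; first by rewrite mulr_ge0 ?(ltW rw_gt0) ?(ltW rm_gt0).
  by rewrite ler_piMr ?(ltW rw_gt0).
rewrite /Kfst; lra.
Qed.

Let second_order_le (N k b : R) : 0 <= N <= S -> 0 <= k <= 2 * (ru * rm) ->
  0 <= b <= 2 * (rw * rm) ->
  6 * (N * b ^+ 2) + 4 * (k * b) + 6 * (k * b ^+ 2) <= rm ^+ 2 * S * Ksnd.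
Proof.
move=> /andP[N0 NS] /andP[k0 kr] /andP[b0 br].
have b2 : b ^+ 2 <= (2 * (rw * rm)) ^+ 2 by rewrite lerXn2r ?nnegrE// (le_trans b0).
have Nb : N * b ^+ 2 <= S * (2 * (rw * rm)) ^+ 2 by rewrite ler_pM ?sqr_ge0.
have kb : k * b <= (2 * (ru * rm)) * (2 * (rw * rm)) by rewrite ler_pM.
have kb2 : k * b ^+ 2 <= (2 * (ru * rm)) * (2 * (rw * rm)) ^+ 2.
  by rewrite ler_pM ?sqr_ge0.
have h0 : 0 <= rm ^+ 2 * (ru * rw) by rewrite !mulr_ge0 ?exprn_ge0// ltW.
have h1 : rm ^+ 2 * (ru * rw) <= rm ^+ 2 * (ru * rw) * S by rewrite ler_peMr.
have h2 : rm ^+ 2 * (ru * rw ^+ 2) * rm <= rm ^+ 2 * (ru * rw ^+ 2) * S.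
  by rewrite ler_wpM2l ?(le_trans rm_le1)// !mulr_ge0 ?exprn_ge0// ltW.
rewrite /Ksnd; lra.
Qed.

Let hsub x y i : hneuron q sig X (pU y i) (pW y i) =
  hneuron q sig X (fun k => pU x i k + pU (psub y x) i k)
                  (fun k l => pW x i k l + pW (psub y x) i k l).
Proof.
congr hneuron; first by apply/funext => k /=; ring.
by apply/funext => k; apply/funext => l /=; ring.
Qed.

(** The [m] terms of size [rm * K] and the outer normalization give [rm^2 * m * K = K]. *)
Let sum_le (F : 'I_m -> R) (K : R) : (forall i, `|F i| <= rm * K) ->
  `|rm * \sum_i F i| <= K.
Proof.
move=> FK; rewrite normrM ger0_norm ?(ltW rm_gt0)//.
have -> : K = rm * (\sum_(i < m) rm * K).
  transitivity (rm ^+ 2 * m%:R * K); first by rewrite rm2 mul1r.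
  by rewrite sumr_const card_ord -mulr_natr; ring.
rewrite ler_wpM2l ?(ltW rm_gt0)//; apply: (le_trans (ler_norm_sum _ _ _)).
by apply: ler_sum => i _; exact: FK.
Qed.

Lemma model_remainder x y : Om x -> Om y ->
  `|model q sig y X - model q sig x X - dmodel q sig x X (psub y x)|
  <= Krem * (s1 * S + s2 * S ^+ 2) * rm.
Proof.
move=> xO yO; rewrite /model /dmodel -!mulrBr -!sumrB; apply: sum_le => i.
have [dc dU dW] := Omega_sub i xO yO.
set u := pU (psub y x) i in dU *; set w := pW (psub y x) i in dW *.
set Dh := dneuron _ _ _ _ _ u w.
have NS : 0 <= norm2 (pU x i) <= S by rewrite norm2_ge0 U_le.
have kr : 0 <= norm2 u <= 2 * (ru * rm) by rewrite norm2_ge0.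
have br : 0 <= frob w <= 2 * (rw * rm) by rewrite frob_ge0.
have h1 := first_order_le NS kr br; have h2 := second_order_le NS kr br.
have z1 : 0 <= 2 * (norm2 (pU x i) * frob w) + norm2 u + 2 * (norm2 u * frob w).
  by rewrite !addr_ge0 ?mulr_ge0 ?norm2_ge0 ?frob_ge0.
have rem := hneuron_remainder T_gt0 dsig ddsig sig1 sig2 X1 q1 (pU x i) u (pW x i) w.
have dle := dneuron_le T_gt0 sig1 X1 q1 (pU x i) (pW x i) u w.
rewrite -hsub -/Dh in rem; rewrite -/Dh in dle.
have {}rem : `|hneuron q sig X (pU y i) (pW y i) - hneuron q sig X (pU x i) (pW x i) - Dh|
    <= rm ^+ 2 * (s2 * S ^+ 2 * Kfst ^+ 2 + s1 * S * Ksnd).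
  apply: (le_trans rem).
  have -> : rm ^+ 2 * (s2 * S ^+ 2 * Kfst ^+ 2 + s1 * S * Ksnd) =
      s2 * (rm * S * Kfst) ^+ 2 + s1 * (rm ^+ 2 * S * Ksnd) by ring.
  by rewrite lerD// ler_wpM2l ?(ltW s1_gt0) ?(ltW s2_gt0)// lerXn2r// nnegrE (le_trans z1).
have {}dle : `|Dh| <= s1 * (rm * S * Kfst).
  apply: (le_trans dle); rewrite ler_wpM2l ?(ltW s1_gt0)//.
  by apply: le_trans h1; rewrite lerDl !mulr_ge0 ?norm2_ge0 ?frob_ge0.
(* An exact splitting: the remainder of the neuron weighted by the new outer weight, plus the cross
   term of the bilinear dependence on the outer weight and the neuron. *)
have -> : pc y i * hneuron q sig X (pU y i) (pW y i)
    - pc x i * hneuron q sig X (pU x i) (pW x i)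
    - (pc (psub y x) i * hneuron q sig X (pU x i) (pW x i) + pc x i * Dh) =
    pc y i * (hneuron q sig X (pU y i) (pW y i) - hneuron q sig X (pU x i) (pW x i) - Dh)
    + pc (psub y x) i * Dh by rewrite /=; ring.
apply: (le_trans (ler_normD _ _)); rewrite (normrM (pc y i)) (normrM (pc (psub y x) i)).
have b1 := ler_pM (normr_ge0 _) (normr_ge0 _) (c_le i yO) rem.
have b2 := ler_pM (normr_ge0 _) (normr_ge0 _) dc dle.
apply: (le_trans (lerD b1 b2)).
have r2 : 0 <= rm ^+ 2 := sqr_ge0 _.
have -> : rm * (Krem * (s1 * S + s2 * S ^+ 2) * rm) =
  rm ^+ 2 * (Krem * (s1 * S + s2 * S ^+ 2)) by ring.
have -> : (1 + rc) * (rm ^+ 2 * (s2 * S ^+ 2 * Kfst ^+ 2 + s1 * S * Ksnd))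
    + 2 * (rc * rm) * (s1 * (rm * S * Kfst)) =
  rm ^+ 2 * ((1 + rc) * (s2 * S ^+ 2 * Kfst ^+ 2 + s1 * S * Ksnd)
    + 2 * rc * (s1 * S * Kfst)) by ring.
rewrite ler_wpM2l//.
have a0 : 0 <= s1 * S by rewrite mulr_ge0 ?(ltW s1_gt0).
have c0 : 0 <= s2 * S ^+ 2 by rewrite mulr_ge0 ?sqr_ge0 ?(ltW s2_gt0).
have F0 := Kfst_ge0; have G0 := Ksnd_ge0; have F2 := sqr_ge0 Kfst.
rewrite -subr_ge0.
have -> : Krem * (s1 * S + s2 * S ^+ 2) -
    ((1 + rc) * (s2 * S ^+ 2 * Kfst ^+ 2 + s1 * S * Ksnd) + 2 * rc * (s1 * S * Kfst)) =
    (1 + rc) * (s1 * S) * Kfst ^+ 2 + (1 + rc) * (s2 * S ^+ 2) * Ksnd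
    + 2 * rc * Kfst * (s2 * S ^+ 2) by rewrite /Krem; ring.
have rc0 := ltW rc_gt0; move: Kfst Ksnd F0 G0 F2 => F G F0 G0 F2.
have rc1 : 0 <= 1 + rc by rewrite addr_ge0.
have s10 := ltW s1_gt0; have s20 := ltW s2_gt0.
by rewrite !addr_ge0// !mulr_ge0// sqr_ge0.
Qed.

Lemma model_diff_le x y : Om x -> Om y ->
  `|model q sig y X - model q sig x X| <= Kmod * (s1 * S).
Proof.
move=> xO yO; rewrite /model -mulrBr -sumrB; apply: sum_le => i.
have [dc dU dW] := Omega_sub i xO yO.
set u := pU (psub y x) i in dU *; set w := pW (psub y x) i in dW *.
have NS : 0 <= norm2 (pU x i) <= S by rewrite norm2_ge0 U_le.
have kr : 0 <= norm2 u <= 2 * (ru * rm) by rewrite norm2_ge0.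
have br : 0 <= frob w <= 2 * (rw * rm) by rewrite frob_ge0.
have h1 := first_order_le NS kr br.
have lip := hneuron_lipschitz T_gt0 dsig sig1 X1 q1 (pU x i) u (pW x i) w.
rewrite -hsub in lip.
have {}lip := le_trans lip (ler_wpM2l (ltW s1_gt0) h1).
have -> : pc y i * hneuron q sig X (pU y i) (pW y i)
    - pc x i * hneuron q sig X (pU x i) (pW x i) =
    pc (psub y x) i * hneuron q sig X (pU y i) (pW y i)
    + pc x i * (hneuron q sig X (pU y i) (pW y i) - hneuron q sig X (pU x i) (pW x i)).
  by rewrite /=; ring.
apply: (le_trans (ler_normD _ _)); rewrite (normrM (pc x i)) (normrM (pc (psub y x) i)).
have b1 := ler_pM (normr_ge0 _) (normr_ge0 _) dc (sig0 (\sum_k pU y i k * attn q X (pW y i) k)).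
have b2 := ler_pM (normr_ge0 _) (normr_ge0 _) (c_le i xO) lip.
apply: (le_trans (lerD b1 b2)).
have -> : rm * (Kmod * (s1 * S)) =
    2 * (rc * rm) * s0 * S + (1 + rc) * (s1 * (rm * S * Kfst)).
  by rewrite /Kmod; field; rewrite ?pnatr_eq0 ?gt_eqF ?sqrtr_gt0 ?ltr0n.
by rewrite lerD2r ler_peMr// !mulr_ge0// ltW.
Qed.

(** A bound on all directions replaces a bound on the norm of the model gradient. Cauchy-Schwarz
    over the neurons costs a factor [m], cancelled by [rm^2]; the 3 comes from squaring a sum of
    three norms. *)
Lemma dmodel_le x z : Om x ->
  dmodel q sig x X z ^+ 2 <= 3 * Kgrad ^+ 2 * (s1 * S) ^+ 2 * pdot z z.
Proof.
move=> xO; pose F i := pc z i * hneuron q sig X (pU x i) (pW x i)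
  + pc x i * dneuron q sig X (pU x i) (pW x i) (pU z i) (pW z i).
rewrite /dmodel -[\sum_i _]/(\sum_i F i) exprMn.
have h1 : (\sum_i F i) ^+ 2 <= m%:R * \sum_i F i ^+ 2.
  have := cauchy_schwarz_sum (fun _ : 'I_m => 1) F.
  under eq_bigr do rewrite mul1r.
  by under [X in _ <= X * _]eq_bigr do rewrite expr1n; rewrite sumr_const card_ord.
apply: (le_trans (ler_wpM2l (sqr_ge0 _) h1)); rewrite mulrA rm2 mul1r.
rewrite pdot_sqr mulr_sumr; apply: ler_sum => i _.
have dle := dneuron_le T_gt0 sig1 X1 q1 (pU x i) (pW x i) (pU z i) (pW z i).
set k := norm2 (pU z i) in dle *; set b := frob (pW z i) in dle *.
have k0 : 0 <= k by exact: norm2_ge0. have b0 : 0 <= b by exact: frob_ge0.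
have Sb : norm2 (pU x i) * b <= S * b by rewrite ler_wpM2r ?U_le.
have kS : k <= S * k by rewrite ler_peMl.
have cS : `|pc z i| <= S * `|pc z i| by rewrite ler_peMl.
have Sb0 : 0 <= S * b by rewrite mulr_ge0.
have Fle : `|F i| <= Kgrad * (s1 * S) * (`|pc z i| + k + b).
  apply: (le_trans (ler_normD _ _)); rewrite (normrM (pc z i)) (normrM (pc x i)).
  have b1 : `|pc z i| * `|hneuron q sig X (pU x i) (pW x i)| <= (S * `|pc z i|) * s0.
    by rewrite ler_pM//; exact: sig0.
  have {}dle : `|dneuron q sig X (pU x i) (pW x i) (pU z i) (pW z i)|
      <= s1 * (2 * (S * b + S * k)).
    by apply: (le_trans dle); rewrite ler_wpM2l ?(ltW s1_gt0)//; lra.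
  have b2 := ler_pM (normr_ge0 _) (normr_ge0 _) (c_le i xO) dle.
  apply: (le_trans (lerD b1 b2)).
  rewrite -subr_ge0.
  have -> : Kgrad * (s1 * S) * (`|pc z i| + k + b) - (S * `|pc z i| * s0 +
      (1 + rc) * (s1 * (2 * (S * b + S * k)))) =
      s0 * S * (k + b) + 2 * (1 + rc) * (s1 * S) * `|pc z i|.
    by rewrite /Kgrad; field; rewrite gt_eqF.
  by rewrite addr_ge0// !mulr_ge0 ?addr_ge0// ltW.
have -> : F i ^+ 2 = `|F i| ^+ 2 by rewrite -normrX ger0_norm ?sqr_ge0.
apply: (@le_trans _ _ ((Kgrad * (s1 * S) * (`|pc z i| + k + b)) ^+ 2)).
  by rewrite lerXn2r// nnegrE (le_trans _ Fle).
have -> : pc z i ^+ 2 = `|pc z i| ^+ 2 by rewrite -normrX ger0_norm ?sqr_ge0.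
have -> : (Kgrad * (s1 * S) * (`|pc z i| + k + b)) ^+ 2 =
  Kgrad ^+ 2 * (s1 * S) ^+ 2 * (`|pc z i| + k + b) ^+ 2 by ring.
have -> : 3 * Kgrad ^+ 2 * (s1 * S) ^+ 2 * (`|pc z i| ^+ 2 + k ^+ 2 + b ^+ 2) =
  Kgrad ^+ 2 * (s1 * S) ^+ 2 * (3 * (`|pc z i| ^+ 2 + k ^+ 2 + b ^+ 2)) by ring.
apply: ler_wpM2l; first by rewrite mulr_ge0 ?sqr_ge0.
rewrite -subr_ge0.
have -> : 3 * (`|pc z i| ^+ 2 + k ^+ 2 + b ^+ 2) - (`|pc z i| + k + b) ^+ 2 =
  (`|pc z i| - k) ^+ 2 + (k - b) ^+ 2 + (`|pc z i| - b) ^+ 2 by ring.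
by rewrite !addr_ge0 ?sqr_ge0.
Qed.

(** The [m] neurons each contribute 1/m times the squared radii, so the diameter does not grow with
    the width. *)
Lemma pdist2_Omega z : Om z -> pdist2 z phi0 <= rc ^+ 2 + ru ^+ 2 + rw ^+ 2.
Proof.
move=> zO; rewrite /pdist2 pdot_sqr.
have -> : rc ^+ 2 + ru ^+ 2 + rw ^+ 2 =
    \sum_(i < m) ((rc * rm) ^+ 2 + (ru * rm) ^+ 2 + (rw * rm) ^+ 2).
  transitivity (rm ^+ 2 * m%:R * (rc ^+ 2 + ru ^+ 2 + rw ^+ 2)).
    by rewrite rm2 mul1r.
  by rewrite sumr_const card_ord -[RHS]mulr_natr; ring.
apply: ler_sum => i _; have [zc [zU zW]] := zO i.
have cE : pc (psub z phi0) i = pc z i - pc phi0 i by rewrite /= mulN1r.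
have UE : pU (psub z phi0) i = (fun k => pU z i k - pU phi0 i k).
  by apply/funext => k; rewrite /= mulN1r.
have WE : pW (psub z phi0) i = (fun k l => pW z i k l - pW phi0 i k l).
  by apply/funext => k; apply/funext => l; rewrite /= mulN1r.
rewrite cE UE WE -[(pc z i - pc phi0 i) ^+ 2]ger0_norm ?sqr_ge0// normrX.
by rewrite !lerD// lerXn2r ?nnegrE ?norm2_ge0 ?frob_ge0 ?mulr_ge0// ltW.
Qed.

End OmegaBounds.

(** * Descent *)

Section Means.
Variable R : realType.

Lemma mean_le n (a : 'I_n -> R) (K : R) : (0 < n)%N -> (forall j, a j <= K) ->
  n%:R^-1 * \sum_j a j <= K.
Proof.
move=> n0 aK; rewrite mulrC ler_pdivrMr ?ltr0n//.
by apply: le_trans (ler_sum _ (fun j _ => aK j)) _; rewrite sumr_const card_ord mulr_natr.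
Qed.

Lemma sqr_mean_le n (a : 'I_n -> R) : (0 < n)%N ->
  (n%:R^-1 * \sum_j a j) ^+ 2 <= n%:R^-1 * \sum_j a j ^+ 2.
Proof.
move=> n0; have n1 : 0 < n%:R :> R by rewrite ltr0n.
have := cauchy_schwarz_sum (fun _ : 'I_n => 1) a.
under eq_bigr do rewrite mul1r.
under [X in _ <= X * _]eq_bigr do rewrite expr1n.
rewrite sumr_const card_ord => h; rewrite exprMn.
apply: (le_trans (ler_wpM2l (sqr_ge0 _) h)).
by rewrite mulrA expr2 -[_ * _ * n%:R]mulrA mulVf ?gt_eqF// mulr1.
Qed.

Lemma sqrD_le (c u e V : R) : c ^+ 2 <= (2 * e) ^+ 2 -> u ^+ 2 <= V ->
  (c + u) ^+ 2 <= 8 * e ^+ 2 + 2 * V.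
Proof.
have -> : (c + u) ^+ 2 = 2 * c ^+ 2 + 2 * u ^+ 2 - (c - u) ^+ 2 by ring.
by rewrite exprMn; have := sqr_ge0 (c - u); lra.
Qed.

(** The default [x] can only lower the minimum, so it is unconstrained. *)
Lemma le_bigmin_sum (f : nat -> R) (x : R) (n : nat) :
  (\big[minr/x]_(s < n) f s) * n%:R <= \sum_(s < n) f s.
Proof.
have : \sum_(s < n) (\big[minr/x]_(s < n) f s) <= \sum_(s < n) f s.
  by apply: ler_sum => s _; exact: (bigmin_le x s (fun s => f (val s))).
by rewrite sumr_const card_ord mulr_natr.
Qed.

End Means.

Section Descent.
Variables (R : realType) (d T m n tau : nat) (q : dat R d T -> vec R d) (sig : R -> R).
Hypotheses (T_gt0 : (0 < T)%N) (n_gt0 : (0 < n)%N) (tau_gt0 : (0 < tau)%N).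
Hypothesis dsig : forall r : R, derivable sig r 1.
Variables (Xs : 'I_n -> dat R d T) (ys : 'I_n -> R).
Variables (A : param R d m -> Prop) (phi : nat -> param R d m) (K1 K2 : R).
Hypothesis phiA : forall s, A (phi s).
Hypotheses (K1_ge0 : 0 <= K1) (K2_ge0 : 0 <= K2).
Local Notation res x j := (model q sig x (Xs j) - ys j).
Hypothesis res_le : forall x j, A x -> `|res x j| <= K1.
Local Notation L := (loss q sig Xs ys).

(** Testing the gradient against itself gives [P <= 2 * K1 * sqrt (K2 * P)] for its squared norm
    [P]; squaring and dividing by [P] concludes when [P] is positive. *)
Lemma sqr_pgrad_loss_le x : A x ->
  (forall j z, dmodel q sig x (Xs j) z ^+ 2 <= K2 * pdot z z) ->
  pdot (pgrad L x) (pgrad L x) <= 4 * K1 ^+ 2 * K2.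
Proof.
move=> xA dmodel_le; set g := pgrad L x; set P := pdot g g.
have P0 : 0 <= P by exact: pdot_ge0.
have : P <= 2 * K1 * Num.sqrt (K2 * P).
  have PE := pdot_pgrad_loss q T_gt0 dsig Xs ys x g.
  rewrite [leLHS]PE; apply: mean_le => // j.
  apply: (le_trans (ler_norm _)); rewrite 2!normrM [`|2|]ger0_norm//.
  apply: ler_pM; rewrite ?mulr_ge0//.
    by rewrite ler_wpM2l ?res_le.
  exact/ler_sqrt_sqr/dmodel_le.
move=> h.
have P2 : P ^+ 2 <= 4 * K1 ^+ 2 * K2 * P.
  have -> : 4 * K1 ^+ 2 * K2 * P = (2 * K1 * Num.sqrt (K2 * P)) ^+ 2.
    by rewrite exprMn sqr_sqrtr ?mulr_ge0//; ring.
  by rewrite lerXn2r// nnegrE (le_trans P0).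
have [P_gt0|P_le0] := ltP 0 P; first by rewrite -(ler_pM2r P_gt0).
by rewrite (le_trans P_le0)// !mulr_ge0// sqr_ge0.
Qed.

Variables (z : param R d m) (E K3 : R).
Hypothesis dmodel_le : forall x j y, A x ->
  dmodel q sig x (Xs j) y ^+ 2 <= K2 * pdot y y.
Hypothesis z_fit : forall x j, A x ->
  `|model q sig x (Xs j) + dmodel q sig x (Xs j) (psub z x) - ys j| <= E.
Hypothesis z_close : pdist2 z (phi 0%N) <= K3.
Local Notation eta := ((Num.sqrt (tau%:R : R))^-1).
Hypothesis phi_step : forall s,
  pdist2 z (phi s.+1) <= pdist2 z (psub (phi s) (pscale eta (pgrad L (phi s)))).

(** This replaces convexity of the loss. Per sample, residual times derivative towards [z] is the
    residual times the fit error at [z], minus the squared residual; the first product is at most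
    [K1 * E]. *)
Lemma loss_le_pdot_pgrad x : A x ->
  2 * L x - 2 * (K1 * E) <= pdot (pgrad L x) (psub x z).
Proof.
move=> xA; rewrite pdot_pgrad_loss//.
have -> : 2 * L x - 2 * (K1 * E) = n%:R^-1 * \sum_j (2 * res x j ^+ 2 - 2 * (K1 * E)).
  rewrite /loss sumrB -mulr_sumr sumr_const card_ord -(mulr_natr _ n); field.
  by rewrite pnatr_eq0 -lt0n.
rewrite ler_wpM2l ?invr_ge0 ?ler0n//; apply: ler_sum => j _.
have -> : psub x z = pscale (-1) (psub z x).
  by apply: param_ext => *; rewrite /=; ring.
rewrite (plinearZ _ _ (plinear_dmodel q sig x (Xs j))).
have := ler_pM (normr_ge0 _) (normr_ge0 _) (res_le j xA) (z_fit j xA).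
rewrite -normrM => h; have {h} := le_trans (ler_norm _) h.
set D := dmodel _ _ _ _ _; set f := model _ _ _ _; set y := ys j.
have -> : (f - y) * (f + D - y) = (f - y) ^+ 2 + (f - y) * D by ring.
by rewrite -!mulrA; lra.
Qed.

(** Since [eta ^+ 2 * tau = 1], the initial distance and the accumulated squared gradients enter
    with the same weight; dividing the regret bound by [4 * eta * tau], that is [4 * sqrt tau],
    gives the rate. *)
Lemma mean_loss_le :
  tau%:R^-1 * \sum_(s < tau) L (phi s) <=
  (K3 + 4 * K1 ^+ 2 * K2) / 4 / Num.sqrt tau%:R + K1 * E.
Proof.
set r := Num.sqrt tau%:R : R.
have r0 : 0 < r by rewrite sqrtr_gt0 ltr0n.
have r2 : tau%:R = r ^+ 2 by rewrite sqr_sqrtr ?ler0n.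
pose G := \sum_(s < tau) pdot (pgrad L (phi s)) (pgrad L (phi s)).
pose D := \sum_(s < tau) pdot (pgrad L (phi s)) (psub (phi s) z).
have reg : 2 * eta * D <= pdist2 z (phi 0%N) + eta ^+ 2 * G.
  exact: (@pgd_regret _ _ _ phi (fun s => pgrad L (phi s)) z eta phi_step tau).
have low : \sum_(s < tau) (2 * L (phi s) - 2 * (K1 * E)) <= (D : R).
  by apply: ler_sum => s _; exact: loss_le_pdot_pgrad.
have up : G <= tau%:R * (4 * K1 ^+ 2 * K2).
  rewrite -ler_pdivrMl ?ltr0n//; apply: mean_le => // s.
  by apply: sqr_pgrad_loss_le => // j y; exact: dmodel_le.
rewrite sumrB -mulr_sumr sumr_const card_ord -(mulr_natr _ tau) in low.
set SL := \sum_(s < tau) L (phi s) in low *.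
have e0 : 0 < eta by rewrite invr_gt0.
have h1 := ler_wpM2l (ltW e0) low.
have h2 := ler_wpM2l (sqr_ge0 eta) up.
have h3 : 2 * (eta * (2 * SL - 2 * (K1 * E) * tau%:R)) <=
    K3 + eta ^+ 2 * (tau%:R * (4 * K1 ^+ 2 * K2)).
  have aux (e e2 D' G' P' U V : R) : 2 * e * D' <= P' + e2 * G' -> e * V <= e * D' ->
      e2 * G' <= e2 * U -> P' <= K3 -> 2 * (e * V) <= K3 + e2 * U by lra.
  exact: aux reg h1 h2 z_close.
have h4 := ler_wpM2l (ltW e0) h3.
have rn : r != 0 by rewrite gt_eqF.
have -> : tau%:R^-1 * SL = (eta * (2 * (eta * (2 * SL - 2 * (K1 * E) * tau%:R)))) / 4 + K1 * E.
  by rewrite -/r r2; field.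
have -> : (K3 + 4 * K1 ^+ 2 * K2) / 4 / r + K1 * E =
   eta * (K3 + eta ^+ 2 * (tau%:R * (4 * K1 ^+ 2 * K2))) / 4 + K1 * E.
  by rewrite -/r r2; field.
by rewrite lerD2r ler_pM2r ?invr_gt0.
Qed.

Lemma loss_pmean_le phi0 (eps : R) : A (pmean phi tau) ->
  (forall x j, A x -> `|model q sig x (Xs j) - model q sig phi0 (Xs j)
     - dmodel q sig phi0 (Xs j) (psub x phi0)| <= eps) ->
  L (pmean phi tau) <= 8 * eps ^+ 2 + 2 * (tau%:R^-1 * \sum_(s < tau) L (phi s)).
Proof.
move=> meanA lin.
have e0 (j : 'I_n) : 0 <= eps := le_trans (normr_ge0 _) (lin _ j meanA).
have key j : res (pmean phi tau) j ^+ 2 <=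
    8 * eps ^+ 2 + 2 * (tau%:R^-1 * \sum_(s < tau) res (phi s) j ^+ 2).
  pose lin_err x := model q sig x (Xs j) - model q sig phi0 (Xs j)
     - dmodel q sig phi0 (Xs j) (psub x phi0).
  pose a := tau%:R^-1 * \sum_(s < tau) res (phi s) j.
  pose b := tau%:R^-1 * \sum_(s < tau) lin_err (phi s).
  (* The linear parts at [phi0] cancel between the mean and the average of the iterates; only their
     linearization errors and the averaged residual remain. *)
  have rE : res (pmean phi tau) j = lin_err (pmean phi tau) - b + a.
    have lD := plinear_dmodel q sig phi0 (Xs j).
    have subE x : dmodel q sig phi0 (Xs j) (psub x phi0) =
        dmodel q sig phi0 (Xs j) x - dmodel q sig phi0 (Xs j) phi0.
      by rewrite lD mulN1r.
    rewrite /a /b /lin_err; under [X in _ - _ * X + _]eq_bigr do rewrite subE.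
    rewrite subE /pmean (plinearZ _ _ lD) (plinear_sum _ _ lD).
    rewrite !sumrB !sumr_const !card_ord -(mulr_natr (ys j)).
    rewrite -(mulr_natr (model q sig phi0 (Xs j))) -(mulr_natr (dmodel q sig phi0 (Xs j) phi0)).
    field.
    by rewrite pnatr_eq0 -lt0n.
  have be : `|b| <= eps.
    rewrite /b normrM ger0_norm ?invr_ge0 ?ler0n//.
    apply: le_trans (ler_wpM2l _ (ler_norm_sum _ _ _)) _; first by rewrite invr_ge0.
    by apply: mean_le => // s; exact: lin.
  have ce : `|lin_err (pmean phi tau) - b| <= 2 * eps.
    by rewrite mulr_natl mulr2n (le_trans (ler_normB _ _))// lerD ?be//; exact: lin.
  have c2 : (lin_err (pmean phi tau) - b) ^+ 2 <= (2 * eps) ^+ 2.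
    by rewrite -[leLHS]ger0_norm ?sqr_ge0// normrX lerXn2r ?nnegrE// mulr_ge0// (e0 j).
  have a2 : a ^+ 2 <= tau%:R^-1 * \sum_(s < tau) res (phi s) j ^+ 2 by exact: sqr_mean_le.
  by rewrite rE; exact: sqrD_le c2 a2.
rewrite {1}/loss.
have -> : 8 * eps ^+ 2 + 2 * (tau%:R^-1 * \sum_(s < tau) L (phi s)) =
    n%:R^-1 * \sum_j (8 * eps ^+ 2 + 2 * (tau%:R^-1 * \sum_(s < tau) res (phi s) j ^+ 2)).
  have -> : \sum_(s < tau) L (phi s) = n%:R^-1 * \sum_j \sum_(s < tau) res (phi s) j ^+ 2.
    by rewrite exchange_big mulr_sumr.
  rewrite big_split/= sumr_const card_ord -!mulr_sumr -(mulr_natr (8 * eps ^+ 2)).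
  by field; rewrite !pnatr_eq0 -!lt0n n_gt0 tau_gt0.
by rewrite ler_wpM2l ?invr_ge0 ?ler0n//; apply: ler_sum => j _; exact: key.
Qed.

End Descent.

(** * Points of the projection set *)

Section OmegaMembership.
Variables (R : realType) (d m : nat) (rc ru rw : R).
Hypotheses (rc0 : 0 <= rc) (ru0 : 0 <= ru) (rw0 : 0 <= rw) (m_gt0 : (0 < m)%N).
Variable phi0 : param R d m.
Hypothesis c01 : forall i, pc phi0 i = 1 \/ pc phi0 i = -1.
Local Notation rm := ((Num.sqrt (m%:R : R))^-1).

Let rm0 : 0 <= rm. Proof. by rewrite invr_ge0 sqrtr_ge0. Qed.

Let c0_norm i : `|pc phi0 i| = 1.
Proof. by case: (c01 i) => ->; rewrite ?normrN1 ?normr1. Qed.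

Lemma in_Omega_transport (vc : R -> vec R d -> mat R d -> R)
    (vu : R -> vec R d -> mat R d -> vec R d) (vw : R -> vec R d -> mat R d -> mat R d) :
  (forall c U W, `|vc c U W| <= rc) -> (forall c U W, norm2 (vu c U W) <= ru) ->
  (forall c U W, frob (vw c U W) <= rw) ->
  in_Omega rc ru rw phi0 (transport vc vu vw phi0).
Proof.
move=> vcb vub vwb i; rewrite /transport /=; split; [|split].
- rewrite addrC addKr normrM (ger0_norm rm0) mulrC.
  by rewrite ler_wpM2r.
- rewrite (_ : (fun k => _) = fun k => pc phi0 i * rm * vu (pc phi0 i) (pU phi0 i) (pW phi0 i) k).
    rewrite [norm2 _]l2Z normrM c0_norm mul1r (ger0_norm rm0) mulrC.
    by rewrite ler_wpM2r//; exact: vub.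
  by apply/funext => k; rewrite addrC addKr.
- rewrite frobE (_ : (fun e => _) = fun e : 'I_d * 'I_d =>
    pc phi0 i * rm * vw (pc phi0 i) (pU phi0 i) (pW phi0 i) e.1 e.2).
    rewrite l2Z normrM c0_norm mul1r (ger0_norm rm0) mulrC -frobE.
    by rewrite ler_wpM2r.
  by apply/funext => e; rewrite addrC addKr.
Qed.

Lemma in_Omega_center : in_Omega rc ru rw phi0 phi0.
Proof.
move=> i; split; [|split].
- by rewrite subrr normr0 mulr_ge0.
- by rewrite /norm2 big1 ?sqrtr0 ?mulr_ge0// => k _; rewrite subrr expr0n.
- rewrite /frob big1 ?sqrtr0 ?mulr_ge0// => k _.
  by rewrite big1// => l _; rewrite subrr expr0n.
Qed.

Lemma Omega_c_le x i : in_Omega rc ru rw phi0 x -> `|pc x i| <= 1 + rc.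
Proof.
move=> /(_ i)[xc _]; rewrite -(c0_norm i) -lerBlDl.
apply: (le_trans _ (le_trans xc _)); first exact: lerB_dist.
rewrite ler_pdivrMr ?sqrtr_gt0 ?ltr0n// ler_peMr//.
by rewrite -[leLHS]sqrtr1 ler_wsqrtr// ler1n.
Qed.

Lemma Omega_U_le x i (B : R) : norm2 (pU phi0 i) <= B ->
  in_Omega rc ru rw phi0 x -> norm2 (pU x i) <= B + ru / Num.sqrt m%:R.
Proof.
move=> U0 /(_ i)[_ [xU _]].
have -> : pU x i = (fun k => pU phi0 i k + (pU x i k - pU phi0 i k)).
  by apply/funext => k; rewrite addrC subrK.
by apply: (le_trans (l2_triangle _ _)); exact: lerD.
Qed.

End OmegaMembership.

(** * Explicit constants and closing inequalities *)

Section Constants.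
Variables (R : realType) (s0 s1 nc nu nw rc ru rw : R).

(** The bound on residuals in units of [L1]: how far the model can move from its initial value 0,
    plus the size of the targets. *)
Definition Kres : R :=
  Kmod s0 s1 rc ru rw + (s0 * nc / s1 + nu + nw * (1 + m2bound R)).

(** The first summand collects distance and squared gradients with [L1^4] factored out, where 12 is
    the 4 of the loss gradient times the 3 of [dmodel_le]. The others multiply [B_app] and the two
    linearization errors by the residual bound. *)
Definition Kcore : R :=
  ((rc ^+ 2 + ru ^+ 2 + rw ^+ 2) / s1 ^+ 4 + 12 * Kres ^+ 2 * Kgrad s0 s1 rc ^+ 2) / 4
  + Kres + 2 * Kres * Krem rc ru rw.

Definition Klin : R := Krem rc ru rw *
  ((rc * Num.sqrt (rw ^+ 2 + ru ^+ 2))^-1 + (rw ^+ 2 + ru ^+ 2)^-1).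

End Constants.

Section Arithmetic.
Variable R : realType.

Lemma comparator_core_le (k e l p b Q : R) :
  0 <= k -> 0 <= e -> 0 <= l -> 0 <= p -> 0 <= b -> 0 <= Q ->
  k * l * (p + 2 * (e * Q)) <= (k + 2 * k * e) * (l * (p + b + Q)).
Proof.
move=> k0 e0 l0 p0 b0 Q0; rewrite -subr_ge0.
have -> : (k + 2 * k * e) * (l * (p + b + Q)) - k * l * (p + 2 * (e * Q)) =
  k * l * (b + Q) + 2 * k * e * l * (p + b) by ring.
by rewrite addr_ge0 ?mulr_ge0 ?addr_ge0.
Qed.

(** The distance term carries no power of [L1]; since [1 <= S], it is at most [K / s^4] times
    [L1^4]. *)
Lemma initial_core_le (K s S k g t : R) :
  0 <= K -> 0 < s -> 1 <= S -> 0 <= t ->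
  (K + 4 * (k * (s * S)) ^+ 2 * (3 * g ^+ 2 * (s * S) ^+ 2)) / 4 * t <=
  (K / s ^+ 4 + 12 * k ^+ 2 * g ^+ 2) / 4 * ((s * S) ^+ 4 * t).
Proof.
move=> K0 s_gt0 S1 t0; rewrite -subr_ge0.
have -> : (K / s ^+ 4 + 12 * k ^+ 2 * g ^+ 2) / 4 * ((s * S) ^+ 4 * t) -
    (K + 4 * (k * (s * S)) ^+ 2 * (3 * g ^+ 2 * (s * S) ^+ 2)) / 4 * t =
    K * (S ^+ 4 - 1) / 4 * t by field; rewrite gt_eqF.
by rewrite !mulr_ge0 ?invr_ge0// subr_ge0 exprn_ege1.
Qed.

Lemma lerD_mulD (a b c e x y : R) : 0 <= c -> 0 <= e -> 0 <= x -> 0 <= y ->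
  a <= c * x -> b <= e * y -> a + b <= (c + e) * (x + y).
Proof.
move=> c0 e0 x0 y0 acx bey; apply: (le_trans (lerD acx bey)); rewrite -subr_ge0.
have -> : (c + e) * (x + y) - (c * x + e * y) = c * y + e * x by ring.
by rewrite addr_ge0 ?mulr_ge0.
Qed.

Lemma mean_core_le (x y c e p b : R) : 0 <= c -> 0 <= e -> 0 <= p -> 0 <= b ->
  x <= e * b -> y <= c * p -> 8 * x + 2 * y <= (2 * c + 8 * e + 1) * (p + b).
Proof.
move=> c0 e0 p0 b0 xb yp.
apply: (@le_trans _ _ (2 * c * p + 8 * e * b)); first lra.
rewrite -subr_ge0.
have -> : (2 * c + 8 * e + 1) * (p + b) - (2 * c * p + 8 * e * b) =
  (8 * e + 1) * p + (2 * c + 1) * b by ring.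
by rewrite addr_ge0 ?mulr_ge0 ?addr_ge0 ?mulr_ge0.
Qed.

(** This compares [L1 + L2] with the weighted combination inside [B_lin]; the inverse weights are
    the origin of [Klin]. *)
Lemma sum_le_weighted (a b x y : R) : 0 < a -> 0 < b -> 0 <= x -> 0 <= y ->
  x + y <= (a^-1 + b^-1) * (x * a + y * b).
Proof.
move=> a0 b0 x0 y0; rewrite -subr_ge0.
have -> : (a^-1 + b^-1) * (x * a + y * b) - (x + y) = y * b / a + x * a / b.
  by field; rewrite !gt_eqF.
by rewrite addr_ge0 ?mulr_ge0 ?invr_ge0 ?(ltW a0) ?(ltW b0).
Qed.

End Arithmetic.

End Development.

Theorem theorem1 (R : realType) (s0 s1 s2 nc nu nw rc ru rw : R) :
  0 < s0 -> 0 < s1 -> 0 < s2 -> 0 < nc -> 0 < nu -> 0 < nw ->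
  0 < rc -> 0 < ru -> 0 < rw -> nc <= rc -> nu <= ru -> nw <= rw ->
  exists C : R, 0 < C /\
  forall (d T m n tau : nat) (sig : R -> R) (q : dat R d T -> vec R d)
    (vc : R -> vec R d -> mat R d -> R) (vu : R -> vec R d -> mat R d -> vec R d)
    (vw : R -> vec R d -> mat R d -> mat R d)
    (Xs : 'I_n -> dat R d T) (phi0 : param R d m) (phi : nat -> param R d m)
    (dl dl' : R),
    (1 <= d)%N -> (1 <= T)%N -> (0 < m)%N -> ~~ odd m -> (1 <= n)%N -> (1 <= tau)%N ->
    (forall u, derivable sig u 1) -> (forall u, derivable (derive1 sig) u 1) ->
    (forall u, `|sig u| <= s0) -> (forall u, `|derive1 sig u| <= s1) ->
    (forall u, `|derive1 (derive1 sig) u| <= s2) ->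
    (forall X, in_Xset X -> norm2 (q X) <= 1) ->
    in_V nc nu nw vc vu vw ->
    (forall j, in_Xset (Xs j)) ->
    0 < dl < 1 -> 0 < dl' < 1 ->
    sym_init phi0 ->
    let ys := fun j => ftilde q sig vc vu vw (Xs j) in
    let L := loss q sig Xs ys in
    let eta := (Num.sqrt (tau%:R))^-1 in
    phi 0%N = phi0 ->
    (forall s : nat,
       let y := psub (phi s) (pscale eta (pgrad L (phi s))) in
       in_Omega rc ru rw phi0 (phi s.+1) /\
       forall z, in_Omega rc ru rw phi0 z -> pdist2 (phi s.+1) y <= pdist2 z y) ->
    event_U phi0 dl' ->
    (forall j, `|f_lin q sig phi0 (transport vc vu vw phi0) (Xs j) - ys j|
                 <= B_app s0 s1 nc nu nw n m dl) ->
    let l1 := L1 s1 d m ru dl' in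
    let l2 := L2 s1 s2 d m ru dl' in
    let blin := B_lin s1 s2 rc ru rw d m dl' in
    let bapp := B_app s0 s1 nc nu nw n m dl in
    let core := l1 ^+ 4 / Num.sqrt (tau%:R)
                + l1 * (bapp + blin + (l1 + l2) / Num.sqrt (m%:R)) in
    \big[minr/L (phi 0%N)]_(s < tau) L (phi s) <= C * core /\
    L (pscale (tau%:R)^-1 (\big[@padd R d m/Param (fun _ => 0) (fun _ _ => 0) (fun _ _ _ => 0)]_(s < tau) phi s))
      <= C * (core + blin ^+ 2).
Proof.
move=> s0p s1p s2p ncp nup nwp rcp rup rwp ncr nur nwr.
set C0 := Kcore s0 s1 nc nu nw rc ru rw; set C1 := Klin rc ru rw.
set Ke := Krem rc ru rw; set Kr := Kres s0 s1 nc nu nw rc ru rw.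
set Kg := Kgrad s0 s1 rc.
have Ke0 : 0 <= Ke by exact: Krem_ge0.
have M0 := m2bound_ge0 R.
have Ky0 : 0 <= s0 * nc / s1 + nu + nw * (1 + m2bound R).
  by rewrite !addr_ge0 ?mulr_ge0 ?invr_ge0 ?addr_ge0 ?(ltW s0p) ?(ltW s1p) ?(ltW ncp)
    ?(ltW nup) ?(ltW nwp).
have Km0 : 0 <= Kmod s0 s1 rc ru rw.
  rewrite /Kmod; have := Kfst_ge0 rup rwp; move: (Kfst ru rw) => F F0.
  by rewrite addr_ge0 ?mulr_ge0 ?invr_ge0 ?addr_ge0 ?(ltW s0p) ?(ltW s1p) ?(ltW rcp).
have Kr0 : 0 <= Kr by exact: addr_ge0.
have C10 : 0 <= (rc ^+ 2 + ru ^+ 2 + rw ^+ 2) / s1 ^+ 4 + 12 * Kr ^+ 2 * Kg ^+ 2.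
  apply: addr_ge0; last by rewrite mulr_ge0 ?sqr_ge0// mulr_ge0 ?sqr_ge0.
  by apply: divr_ge0; [rewrite !addr_ge0 ?sqr_ge0|rewrite exprn_ge0 ?(ltW s1p)].
have C00 : 0 <= C0.
  apply: addr_ge0; last by apply: mulr_ge0 => //; exact: mulr_ge0.
  by apply: addr_ge0 => //; exact: divr_ge0.
(* The minimum needs only [C0]. The averaged iterate needs twice that, plus [8 * C1 ^+ 2] for the
   squared linearization errors; the final 1 ensures positivity. *)
exists (2 * C0 + 8 * C1 ^+ 2 + 1); split.
  apply: ltr_wpDl => //; apply: addr_ge0; first exact: mulr_ge0.
  by apply: mulr_ge0 => //; exact: sqr_ge0.
move=> d T m n tau sig q vc vu vw Xs phi0 phi dl dl' d1 T1 m0 meven n1 tau1.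
move=> dsig ddsig sig0 sig1 sig2 q1 [_ [_ [_ [vcb [vub vwb]]]]] X1 _ _ sym ys L eta.
move=> phi00 pgd evU app l1 l2 blin bapp core.
have [c01 _] := sym.
set B := B_U d m ru dl'; set S := Num.sqrt (1 + B ^+ 2).
have l1E : l1 = s1 * S by [].
have B2S : 1 + B ^+ 2 = S ^+ 2 by rewrite sqr_sqrtr// addr_ge0// sqr_ge0.
have dB : Num.sqrt d%:R <= B.
  rewrite /B /B_U -addrA lerDl addr_ge0 ?sqrtr_ge0//.
  by rewrite divr_ge0 ?sqrtr_ge0 ?(ltW rup).
have B0 : 0 <= B := le_trans (sqrtr_ge0 _) dB.
have BS : B <= S by rewrite -[leLHS]ger0_norm// ler_sqrt_sqr// lerDr.
have S1 : 1 <= S by rewrite -[leLHS]sqrtr1 ler_wsqrtr// lerDl sqr_ge0.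
have S0 : 0 <= S := le_trans ler01 S1.
have l10 : 0 <= l1 by rewrite l1E; apply: mulr_ge0 => //; exact: ltW.
have l2E : l2 = s2 * S ^+ 2 + 8 * s1 * S by rewrite -B2S.
have l2S : s2 * S ^+ 2 <= l2.
  rewrite l2E lerDl; apply: mulr_ge0 => //; apply: mulr_ge0 => //; exact: ltW.
have l20 : 0 <= l2.
  apply: le_trans l2S; apply: mulr_ge0; [exact: ltW|exact: sqr_ge0].
set r := (Num.sqrt (m%:R : R))^-1.
have r0 : 0 < r by rewrite invr_gt0 sqrtr_gt0 ltr0n.
set rem := Ke * (l1 + l2) * r.
have rem0 : 0 <= rem.
  apply: mulr_ge0; last exact: ltW.
  by apply: mulr_ge0 => //; exact: addr_ge0.
pose Om := in_Omega rc ru rw phi0.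
set z := transport vc vu vw phi0.
have zO : Om z.
  apply: in_Omega_transport => // *; first exact: le_trans (vcb _ _ _) ncr.
    exact: le_trans (vub _ _ _) nur.
  exact: le_trans (vwb _ _ _) nwr.
have phi0O : Om phi0 by apply: in_Omega_center => //; exact: ltW.
have phiO s : Om (phi s) by case: s => [|s]; [rewrite phi00|case: (pgd s)].
have cle x i : Om x -> `|pc x i| <= 1 + rc by move=> xO; apply: Omega_c_le xO => //; exact: ltW.
have Ule x i : Om x -> norm2 (pU x i) <= S.
  by move=> xO; apply: le_trans BS; exact: Omega_U_le (evU i) xO.
have remainder x y j : Om x -> Om y ->
    `|model q sig y (Xs j) - model q sig x (Xs j) - dmodel q sig x (Xs j) (psub y x)| <= rem.
  move=> xO yO.
  have h := model_remainder T1 m0 dsig ddsig s1p s2p rcp rup rwp S1 sig1 sig2 cle Ule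
    (X1 j) (q1 _ (X1 j)) xO yO.
  apply: (le_trans h).
  by rewrite ler_wpM2r ?(ltW r0)// ler_wpM2l// -l1E lerD2l.
have ys_le j : `|ys j| <= (s0 * nc / s1 + nu + nw * (1 + m2bound R)) * l1.
  apply: le_trans (norm_ftilde_le d1 T1 (ltW s0p) (ltW s1p) (ltW ncp) (ltW nup) (ltW nwp)
    sig0 sig1 vcb vub vwb (X1 j) (q1 _ (X1 j))) _.
  have -> : (s0 * nc / s1 + nu + nw * (1 + m2bound R)) * l1 =
      s0 * nc * S + s1 * nu * S + s1 * nw * (1 + m2bound R) * S.
    by rewrite l1E; field; rewrite gt_eqF.
  have a0 : 0 <= s0 * nc by rewrite mulr_ge0 ?ltW.
  have b0 : 0 <= s1 * nu by rewrite mulr_ge0 ?ltW.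
  have c0 : 0 <= s1 * nw * (1 + m2bound R) by rewrite !mulr_ge0 ?addr_ge0 ?(ltW s1p) ?(ltW nwp).
  apply: lerD; last by rewrite ler_wpM2l// (le_trans dB).
  by apply: lerD; rewrite ler_peMr.
have res_le x j : Om x -> `|model q sig x (Xs j) - ys j| <= Kr * l1.
  move=> xO; rewrite /Kr /Kres mulrDl; apply: (le_trans (ler_normB _ _)); apply: lerD => //.
  rewrite -[model _ _ _ _]subr0 -(model_sym_init q sig (Xs j) meven sym) l1E.
  exact: (model_diff_le T1 m0 dsig s0p s1p rcp rup rwp S1 sig0 sig1 cle Ule
    (X1 j) (q1 _ (X1 j)) phi0O xO).
have grad_le x j y : Om x ->
    dmodel q sig x (Xs j) y ^+ 2 <= 3 * Kg ^+ 2 * l1 ^+ 2 * pdot y y.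
  move=> xO; exact: (dmodel_le T1 m0 s0p s1p rcp S1 sig0 sig1 cle Ule
    (X1 j) (q1 _ (X1 j)) y xO).
(* The model value at [z] is the intermediate point: the linearizations at [x] and at [phi0],
   evaluated at [z], each miss it by at most [rem]. *)
have z_fit x j : Om x ->
    `|model q sig x (Xs j) + dmodel q sig x (Xs j) (psub z x) - ys j| <= bapp + 2 * rem.
  move=> xO.
  have h1 := remainder x z j xO zO; have h2 := remainder phi0 z j phi0O zO.
  have h3 := app j; rewrite /f_lin pdot_pgrad_model// -/z -/bapp in h3.
  set D := dmodel q sig x _ _ in h1 *; set D0 := dmodel q sig phi0 _ _ in h2 h3.
  move: h1 h2 h3; rewrite !ler_norml => /andP[? ?] /andP[? ?] /andP[? ?].
  apply/andP; split; lra.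
have z_close : pdist2 z (phi 0%N) <= rc ^+ 2 + ru ^+ 2 + rw ^+ 2.
  by rewrite phi00; exact: pdist2_Omega.
have step s : pdist2 z (phi s.+1) <= pdist2 z (psub (phi s) (pscale eta (pgrad L (phi s)))).
  have [sO smin] := pgd s.
  apply: (@projection_nonexpansive _ _ _ Om) smin => t t01.
  exact: in_Omega_segment.
have K10 : 0 <= Kr * l1 by exact: mulr_ge0.
have K20 : 0 <= 3 * Kg ^+ 2 * l1 ^+ 2.
  by apply: mulr_ge0; [apply: mulr_ge0 => //; exact: sqr_ge0|exact: sqr_ge0].
have avg := mean_loss_le T1 n1 tau1 dsig phiO K10 K20 res_le grad_le z_fit z_close step.
have meanO : Om (pmean phi tau) by exact: in_Omega_pmean.
have mean_loss := loss_pmean_le n1 tau1 ys phiO meanO (fun x j xO => remainder phi0 x j phi0O xO).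
have bapp0 : 0 <= bapp.
  rewrite /bapp /B_app; apply: mulr_ge0; last exact: sqrtr_ge0.
  by rewrite !mulr_ge0 ?addr_ge0 ?mulr_ge0 ?(ltW s0p) ?(ltW s1p) ?(ltW ncp) ?(ltW nup) ?(ltW nwp).
have b_gt0 : 0 < rw ^+ 2 + ru ^+ 2 by rewrite addr_gt0 ?exprn_gt0.
have a_gt0 : 0 < rc * Num.sqrt (rw ^+ 2 + ru ^+ 2) by rewrite mulr_gt0 ?sqrtr_gt0.
have blinE : blin = r * (l1 * (rc * Num.sqrt (rw ^+ 2 + ru ^+ 2)) + l2 * (rw ^+ 2 + ru ^+ 2)).
  by rewrite [l1 * _]mulrA.
have blin0 : 0 <= blin.
  rewrite blinE; apply: mulr_ge0; first exact: ltW.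
  by apply: addr_ge0; apply: mulr_ge0 => //; exact: ltW.
(* Used only for the squared errors of the averaged iterate; in the averaged loss, [rem] is matched
   with the term [(l1 + l2) / sqrt m] of [core]. *)
have rem_lin : rem <= C1 * blin.
  have h := sum_le_weighted a_gt0 b_gt0 l10 l20.
  have swap (k w e x : R) : k * w * (e * x) = e * (k * (w * x)) by ring.
  rewrite blinE [leRHS]swap /rem [leLHS]mulrC.
  apply: ler_wpM2l; first exact: ltW.
  exact: ler_wpM2l.
pose Q := (l1 + l2) * r.
have Q0 : 0 <= Q by apply: mulr_ge0; [exact: addr_ge0|exact: ltW].
have core0 : 0 <= core.
  apply: addr_ge0; first by apply: divr_ge0; [exact: exprn_ge0|exact: sqrtr_ge0].
  by apply: mulr_ge0 => //; apply: addr_ge0 => //; exact: addr_ge0.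
have avg_core : tau%:R^-1 * \sum_(s < tau) L (phi s) <= C0 * core.
  apply: (le_trans avg).
  have K30 : 0 <= rc ^+ 2 + ru ^+ 2 + rw ^+ 2 by rewrite !addr_ge0 ?sqr_ge0.
  have t0 : 0 <= eta by rewrite invr_ge0 sqrtr_ge0.
  have h1 := initial_core_le Kr Kg K30 s1p S1 t0.
  have h2 := comparator_core_le Kr0 Ke0 l10 bapp0 blin0 Q0.
  have -> : C0 = ((rc ^+ 2 + ru ^+ 2 + rw ^+ 2) / s1 ^+ 4 + 12 * Kr ^+ 2 * Kg ^+ 2) / 4
      + (Kr + 2 * Kr * Ke) by rewrite addrA.
  have remQ : rem = Ke * Q by rewrite /rem mulrA.
  rewrite -remQ in h2.
  apply: lerD_mulD h1 h2.
  - exact: divr_ge0.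
  - by apply: addr_ge0 => //; apply: mulr_ge0 => //; exact: mulr_ge0.
  - by apply: mulr_ge0 => //; exact: exprn_ge0.
  - by apply: mulr_ge0 => //; apply: addr_ge0 => //; exact: addr_ge0.
have C1sq : 0 <= 8 * C1 ^+ 2 by apply: mulr_ge0 => //; exact: sqr_ge0.
split.
  have tau0 : 0 < tau%:R :> R by rewrite ltr0n.
  have min_avg : \big[minr/L (phi 0%N)]_(s < tau) L (phi s) <=
      tau%:R^-1 * \sum_(s < tau) L (phi s).
    by rewrite ler_pdivlMl// mulrC (le_bigmin_sum (fun s => L (phi s))).
  apply: (le_trans min_avg); apply: (le_trans avg_core); apply: ler_wpM2r => //.
  by rewrite -addrA mulr_natl mulr2n -addrA lerDl; do 2!apply: addr_ge0 => //.
have -> : pscale (tau%:R)^-1 (\big[@padd R d m/Param (fun _ => 0) (fun _ _ => 0)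
  (fun _ _ _ => 0)]_(s < tau) phi s) = pmean phi tau by [].
apply: (le_trans mean_loss).
have rem2 : rem ^+ 2 <= C1 ^+ 2 * blin ^+ 2.
  rewrite -exprMn; apply: lerXn2r => //; rewrite nnegrE//.
  exact: le_trans rem_lin.
apply: mean_core_le => //; exact: sqr_ge0.
Qed.
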